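(* Let $l\ge 3$, $0<t<\frac{\pi}{4}$, and let $M_t\subset S^{2l-1}(1)$ be the isoparametric hypersurface with $(g,m_1,m_2)=(4,1,l-2)$, with the complex structure $J$ and the Hermitian metric $ds^2$ described in the context. Then the Hermitian manifold $(M_t,ds^2,J)$ is not balanced.
   Context: Identify $\mathbb{R}^{2l}=\mathbb{C}^l=\mathbb{R}^l\oplus\sqrt{-1}\,\mathbb{R}^l$ with the standard real inner product. Let $V_2(\mathbb{R}^l)$ be the set of orthonormal pairs $(u,v)$ in $\mathbb{R}^l$. For $0<t<\frac{\pi}{4}$, $$M_t=\{x=e^{\sqrt{-1}\theta}(\cos t\,u+\sqrt{-1}\sin t\,v):\theta\in\mathbb{R},\ (u,v)\in V_2(\mathbb{R}^l)\}\subset S^{2l-1}(1),$$ an isoparametric hypersurface with $(g,m_1,m_2)=(4,1,l-2)$. At such an $x$ the principal distributions are $\mathcal{D}_1=\mathrm{Span}\{X_1\}$, $X_1=\frac{1}{\sqrt2}e^{\sqrt{-1}\theta}(v-\sqrt{-1}u)$; $\mathcal{D}_2=\{e^{\sqrt{-1}\theta}w: w\in\mathbb{R}^l,\ w\perp u,v\}$; $\mathcal{D}_3=\mathrm{Span}\{X_3\}$, $X_3=\frac{1}{\sqrt2}e^{\sqrt{-1}\theta}(v+\sqrt{-1}u)$; $\mathcal{D}_4=\{\sqrt{-1}e^{\sqrt{-1}\theta}w: w\in\mathbb{R}^l,\ w\perp u,v\}$. The complex structure $J$ is $$JX_1=-\cot(t+\tfrac{\pi}{4})X_3,\quad JX_3=-\cot(t+\tfrac{3\pi}{4})X_1,\quad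 JX=-\cot(t+\tfrac{\pi}{2})\sqrt{-1}X\ (X\in\mathcal{D}_2),\quad JX=\cot(t)\sqrt{-1}X\ (X\in\mathcal{D}_4)$$ (it is an integrable almost complex structure). The metric $ds^2$ is obtained from the induced metric $\langle\cdot,\cdot\rangle$ by keeping $\mathcal{D}_1,\mathcal{D}_2,\mathcal{D}_3,\mathcal{D}_4$ mutually orthogonal and rescaling on $\mathcal{D}_i$ by the constants $c_1=\frac{\sin t+\cos t}{\sqrt2}$, $c_2=\cos t$, $c_3=\frac{\sin t-\cos t}{\sqrt2}$, $c_4=\sin t$, in the sense that $ds^2=c_i^{-2}\langle\cdot,\cdot\rangle$ on $\mathcal{D}_i$ (so $c_i$ times an $\langle\cdot,\cdot\rangle$-orthonormal basis of $\mathcal{D}_i$ is $ds^2$-orthonormal); it is Hermitian for $J$. A Hermitian metric on a complex manifold of complex dimension $n$ is balanced if its Kähler form $\omega$, $\omega(X,Y)=ds^2(JX,Y)$, satisfies $d(\omega^{n-1})=0$. *)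

(* Defs.v *)
From HB Require Import structures.
From mathcomp Require Import all_boot all_order all_algebra all_fingroup.
From mathcomp Require Import all_classical all_reals all_analysis.
From mathcomp Require Import ring lra.

Set Implicit Arguments.
Unset Strict Implicit.
Unset Printing Implicit Defensive.

Import Order.TTheory GRing.Theory Num.Theory numFieldNormedType.Exports.
Local Open Scope classical_set_scope.
Local Open Scope ring_scope.

(* k-linear forms on V; alternation is a property, not part of the type. *)
Definition form (R : realType) (V : Type) (k : nat) := ('I_k -> V) -> R.

(* Normalised so that (a /\ b)(v, w) = a v * b w - a w * b v for 1-forms. *)
Definition wedge (R : realType) (V : Type) (p q : nat)
    (a : form R V p) (b : form R V q) : form R V (p + q) :=
  fun v => (p`! * q`!)%:R^-1 *
    \sum_(s : 'S_(p + q)) (-1) ^+ s * a (fun i => v (s (lshift q i)))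
                                    * b (fun j => v (s (rshift p j))).

Fixpoint wedge_exp (R : realType) (V : Type) (w : form R V 2) (k : nat) :
    form R V k.*2 :=
  match k with
  | 0 => fun=> 1
  | k'.+1 => wedge w (@wedge_exp R V w k')
  end.
Arguments wedge_exp {R V} w k.

Fixpoint Ck_on (R : realType) (m : nat) (W : normedModType R) (k : nat)
    (U : set 'rV[R]_m) (f : 'rV[R]_m -> W) : Prop :=
  match k with
  | 0 => forall p, U p -> {for p, continuous f}
  | k'.+1 => (forall p, U p -> differentiable f p) /\
      (forall i : 'I_m, Ck_on k' U (fun p => 'D_(delta_mx 0 i) f p))
  end.

Definition smooth_on (R : realType) (m : nat) (W : normedModType R)
    (U : set 'rV[R]_m) (f : 'rV[R]_m -> W) : Prop :=
  forall k, Ck_on k U f.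

(* A differential k-form on an open subset of R^m. Its exterior derivative is
   the alternation of its differential,
   d beta (v_0, ..., v_k) =
     sum_i (-1)^i D_(v_i) [beta (v_0, ..., omit v_i, ..., v_k)]
   for constant vectors v_j. *)
Definition ext_d (R : realType) (m k : nat)
    (beta : 'rV[R]_m -> form R 'rV[R]_m k) : 'rV[R]_m -> form R 'rV[R]_m k.+1 :=
  fun p v => \sum_(i < k.+1)
    (-1) ^+ i * 'D_(v i) (fun q => beta q (fun j => v (lift i j))) p.

Definition pullback (R : realType) (m : nat) (V : normedModType R) (k : nat)
    (phi : 'rV[R]_m -> V) (alpha : V -> form R V k) :
    'rV[R]_m -> form R 'rV[R]_m k :=
  fun p v => alpha (phi p) (fun i => 'D_(v i) phi p).

(* Local parametrisation of an m-dimensional submanifold M of V. Since m is the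
   dimension of M, an immersion into M is a local diffeomorphism onto open
   pieces of M; injectivity of phi is not asked for, as closedness of a form is
   local and U can be shrunk. *)
Definition local_param (R : realType) (V : normedModType R) (M : set V)
    (m : nat) (U : set 'rV[R]_m) (phi : 'rV[R]_m -> V) : Prop :=
  [/\ open U,
      smooth_on U phi,
      forall p, U p -> injective ('d phi p) &
      forall p, U p -> M (phi p)].

(* d alpha = 0 on the m-dimensional submanifold M: the coordinate expression of
   d alpha vanishes in every local parametrisation. Only the values of alpha at
   points of M on vectors tangent to M matter. *)
Definition closed_form (R : realType) (V : normedModType R) (M : set V)
    (m k : nat) (alpha : V -> form R V k) : Prop :=
  forall (U : set 'rV[R]_m) (phi : 'rV[R]_m -> V), local_param M U phi ->
  forall p, U p -> forall v : 'I_k.+1 -> 'rV[R]_m,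
    ext_d (pullback phi alpha) p v = 0.

Definition kahler_form (R : realType) (V : normedModType R)
    (J : V -> V -> V) (g : V -> V -> V -> R) : V -> form R V 2 :=
  fun x v => g x (J x (v ord0)) (v ord_max).

(* M of complex dimension n; J x and g x are the complex structure and the
   Hermitian metric on the tangent space of M at x. *)
Definition balanced (R : realType) (V : normedModType R) (n : nat) (M : set V)
    (J : V -> V -> V) (g : V -> V -> V -> R) : Prop :=
  closed_form M n.*2 (fun x => wedge_exp (kahler_form J g x) n.-1).

(* C^l = R^l + i R^l, as pairs (real part, imaginary part). *)
Notation Cvec R l := ('rV[R]_l * 'rV[R]_l)%type.

Definition cot (R : realType) (a : R) : R := cos a / sin a.

Definition rdot (R : realType) (l : nat) (u v : 'rV[R]_l) : R :=
  \sum_i u 0 i * v 0 i.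

Definition cdot (R : realType) (l : nat) (x y : Cvec R l) : R :=
  rdot x.1 y.1 + rdot x.2 y.2.

Definition mulI (R : realType) (l : nat) (x : Cvec R l) : Cvec R l :=
  (- x.2, x.1).

(* e^(i th) x *)
Definition rot (R : realType) (l : nat) (th : R) (x : Cvec R l) : Cvec R l :=
  cos th *: x + sin th *: mulI x.

Definition V2 (R : realType) (l : nat) (u v : 'rV[R]_l) : Prop :=
  [/\ rdot u u = 1, rdot v v = 1 & rdot u v = 0].

Definition Mpt (R : realType) (l : nat) (t th : R) (u v : 'rV[R]_l) :
    Cvec R l :=
  rot th (cos t *: u, sin t *: v).

Definition Mt (R : realType) (l : nat) (t : R) : set (Cvec R l) :=
  [set x | exists th u v, V2 u v /\ x = Mpt t th u v].

Definition X1 (R : realType) (l : nat) (th : R) (u v : 'rV[R]_l) : Cvec R l :=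
  (Num.sqrt 2)^-1 *: rot th (v, - u).

Definition X3 (R : realType) (l : nat) (th : R) (u v : 'rV[R]_l) : Cvec R l :=
  (Num.sqrt 2)^-1 *: rot th (v, u).

Definition D2 (R : realType) (l : nat) (th : R) (u v : 'rV[R]_l) :
    set (Cvec R l) :=
  [set x | exists w, [/\ rdot w u = 0, rdot w v = 0 & x = rot th (w, 0)]].

Definition D4 (R : realType) (l : nat) (th : R) (u v : 'rV[R]_l) :
    set (Cvec R l) :=
  [set x | exists w, [/\ rdot w u = 0, rdot w v = 0 & x = mulI (rot th (w, 0))]].

Definition perp_part (R : realType) (l : nat) (u v w : 'rV[R]_l) : 'rV[R]_l :=
  w - rdot w u *: u - rdot w v *: v.

(* Orthogonal projections of C^l onto the four principal distributions. *)
Definition P1 (R : realType) (l : nat) (th : R) (u v : 'rV[R]_l)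
    (x : Cvec R l) : Cvec R l := cdot x (X1 th u v) *: X1 th u v.

Definition P2 (R : realType) (l : nat) (th : R) (u v : 'rV[R]_l)
    (x : Cvec R l) : Cvec R l :=
  rot th (perp_part u v (rot (- th) x).1, 0).

Definition P3 (R : realType) (l : nat) (th : R) (u v : 'rV[R]_l)
    (x : Cvec R l) : Cvec R l := cdot x (X3 th u v) *: X3 th u v.

Definition P4 (R : realType) (l : nat) (th : R) (u v : 'rV[R]_l)
    (x : Cvec R l) : Cvec R l :=
  mulI (rot th (perp_part u v (rot (- th) x).2, 0)).

(* Linear extension of the values of J on the four distributions. *)
Definition J_at (R : realType) (l : nat) (t th : R) (u v : 'rV[R]_l)
    (x : Cvec R l) : Cvec R l :=
  (- cot (t + pi / 4) * cdot x (X1 th u v)) *: X3 th u v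
  + (- cot (t + 3 * pi / 4) * cdot x (X3 th u v)) *: X1 th u v
  + (- cot (t + pi / 2)) *: mulI (P2 th u v x)
  + cot t *: mulI (P4 th u v x).

Definition c1 (R : realType) (t : R) : R := (sin t + cos t) / Num.sqrt 2.
Definition c2 (R : realType) (t : R) : R := cos t.
Definition c3 (R : realType) (t : R) : R := (sin t - cos t) / Num.sqrt 2.
Definition c4 (R : realType) (t : R) : R := sin t.

Definition ds2_at (R : realType) (l : nat) (t th : R) (u v : 'rV[R]_l)
    (x y : Cvec R l) : R :=
  c1 t ^- 2 * cdot (P1 th u v x) (P1 th u v y)
  + c2 t ^- 2 * cdot (P2 th u v x) (P2 th u v y)
  + c3 t ^- 2 * cdot (P3 th u v x) (P3 th u v y)
  + c4 t ^- 2 * cdot (P4 th u v x) (P4 th u v y).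

(* A chosen representation x = e^(i th) (cos t u + i sin t v) of a point of M_t.
   It is unique up to (th, u, v) ~ (th + pi, - u, - v) (and th mod 2 pi), which
   changes neither J_at nor ds2_at: see J_Mpt and ds2_Mpt. *)
Definition frame (R : realType) (l : nat) (t : R) (x : Cvec R l) :
    R * 'rV[R]_l * 'rV[R]_l :=
  get [set f | V2 f.1.2 f.2 /\ x = Mpt t f.1.1 f.1.2 f.2].

Definition J (R : realType) (l : nat) (t : R) (x X : Cvec R l) : Cvec R l :=
  let: (th, u, v) := frame t x in J_at t th u v X.

Definition ds2 (R : realType) (l : nat) (t : R) (x X Y : Cvec R l) : R :=
  let: (th, u, v) := frame t x in ds2_at t th u v X Y.

Section Calculus.
Context (R : realType) (l : nat).
Implicit Types (t th : R) (u v w : 'rV[R]_l) (x y z : Cvec R l).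

Lemma rdotC u v : rdot u v = rdot v u.
Proof. by apply: eq_bigr => i _; rewrite mulrC. Qed.

Lemma rdotDl u v w : rdot (u + v) w = rdot u w + rdot v w.
Proof. by rewrite -big_split; apply: eq_bigr => i _; rewrite mxE mulrDl. Qed.

Lemma rdotZl a u w : rdot (a *: u) w = a * rdot u w.
Proof. by rewrite mulr_sumr; apply: eq_bigr => i _; rewrite mxE mulrA. Qed.

Lemma rdotNl u w : rdot (- u) w = - rdot u w.
Proof. by rewrite -scaleN1r rdotZl mulN1r. Qed.

Lemma rdotDr u v w : rdot w (u + v) = rdot w u + rdot w v.
Proof. by rewrite rdotC rdotDl !(rdotC w). Qed.

Lemma rdotZr a u w : rdot w (a *: u) = a * rdot w u.
Proof. by rewrite rdotC rdotZl !(rdotC w). Qed.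

Lemma rdotNr u w : rdot w (- u) = - rdot w u.
Proof. by rewrite rdotC rdotNl !(rdotC w). Qed.

Lemma rdot0l w : rdot 0 w = 0.
Proof. by rewrite -(scale0r 0) rdotZl mul0r. Qed.

Lemma rdot0r w : rdot w 0 = 0.
Proof. by rewrite rdotC rdot0l. Qed.

Definition rdotE := (rdotDl, rdotDr, rdotNl, rdotNr, rdotZl, rdotZr,
  rdot0l, rdot0r).

Lemma rotE th x : rot th x =
  (cos th *: x.1 - sin th *: x.2, cos th *: x.2 + sin th *: x.1).
Proof. by rewrite /rot /mulI; case: x => a b /=; rewrite -scalerN. Qed.

Lemma cs th : cos th ^+ 2 + sin th ^+ 2 = 1.
Proof. exact: cos2Dsin2. Qed.

Lemma rot_rot th th' x : rot th (rot th' x) = rot (th + th') x.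
Proof.
rewrite !rotE /= cosD sinD; congr pair; apply/rowP => i; rewrite !mxE; ring.
Qed.

Lemma rot0 x : rot 0 x = x.
Proof. by rewrite rotE cos0 sin0 !scale1r !scale0r subr0 addr0; case: x. Qed.

Lemma rotK th x : rot (- th) (rot th x) = x.
Proof. by rewrite rot_rot addNr rot0. Qed.

Lemma rotN th x : rot th (- x) = - rot th x.
Proof. by rewrite !rotE /=; congr pair; apply/rowP => i; rewrite !mxE; ring. Qed.

Lemma cdot_rot th x y : cdot (rot th x) (rot th y) = cdot x y.
Proof.
rewrite !rotE /cdot /= !rdotE.
move: (cs th); set c := cos th; set s := sin th => h.
transitivity ((c ^+ 2 + s ^+ 2) * (rdot x.1 y.1 + rdot x.2 y.2)); first ring.
by rewrite h mul1r.
Qed.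

Lemma mulI_rot th x : mulI (rot th x) = rot th (mulI x).
Proof.
by rewrite !rotE /mulI /=; congr pair; apply/rowP => i; rewrite !mxE; ring.
Qed.

Lemma c_gt_s t : 0 < t < pi / 4 -> [/\ 0 < sin t, 0 < cos t & sin t < cos t].
Proof.
move=> /andP[t0 t4].
have p0 : 0 < pi :> R := pi_gt0 R.
have s0 : 0 < sin t by apply: sin_gt0_pi; rewrite ?t0 //; apply/andP; split => //; lra.
have k0 : 0 < cos t by apply: cos_gt0_pihalf; apply/andP; split; lra.
split => //.
have : 0 < cos (t + t) by apply: cos_gt0_pihalf; apply/andP; split; lra.
rewrite cosD subr_gt0 => h.
rewrite ltNge; apply/negP => h'.
have : cos t * cos t <= sin t * sin t by apply: ler_pM => //; exact: ltW.
by rewrite leNgt h.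
Qed.

Lemma Mpt_inj t th th' u v u' v' : 0 < t < pi / 4 ->
  V2 u v -> V2 u' v' -> Mpt t th u v = Mpt t th' u' v' ->
  exists2 e : bool, (u' = (-1) ^+ e *: u /\ v' = (-1) ^+ e *: v) &
    forall x, rot th' x = (-1) ^+ e *: rot th x.
Proof.
move=> /c_gt_s[s0 k0 sk] [uu vv uv] [uu' vv' uv'] E.
pose d := th - th'.
have Ed : rot d (cos t *: u, sin t *: v) = (cos t *: u', sin t *: v').
  rewrite -[RHS](rotK th') -/(Mpt t th' u' v') -E /Mpt rot_rot.
  by congr (rot _ _); rewrite /d addrC.
move: Ed; rewrite rotE /= => -[E1 E2].
have : rdot (cos t *: u') (cos t *: u') = cos t ^+ 2 by rewrite !rdotE uu'; ring.
rewrite -E1 !rdotE uu vv uv (rdotC v u) uv => H.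
have sd : sin d = 0.
  have : sin d ^+ 2 * (cos t ^+ 2 - sin t ^+ 2) = 0.
    have := cs d; move: H; set c := cos d; set s := sin d => H h.
    transitivity ((c ^+ 2 + s ^+ 2) * cos t ^+ 2
      - (c ^+ 2 * cos t ^+ 2 + s ^+ 2 * sin t ^+ 2)); first ring.
    by rewrite h mul1r -[X in X - _]H; ring.
  move=> /eqP; rewrite mulf_eq0 expf_eq0 /= => /orP[/eqP //|/eqP h].
  nra.
have cd : cos d ^+ 2 = 1 by rewrite -(cs d) sd; ring.
have /orP cdE : (cos d == 1) || (cos d == -1) by rewrite -sqrf_eq1 cd.
exists (cos d == -1) => [|x].
  move: E1 E2; rewrite sd !scale0r subr0 addr0 !scalerA ![cos d * _]mulrC.
  rewrite -!scalerA => E1 E2.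
  have e1 := scalerI (lt0r_neq0 k0) E1; have e2 := scalerI (lt0r_neq0 s0) E2.
  rewrite -e1 -e2.
  case: cdE => /eqP->; first by rewrite eq_sym eqNr oner_eq0 ?scale1r.
  by rewrite eqxx.
have -> : th' = - d + th by rewrite /d; ring.
rewrite -rot_rot rotE cosN sinN sd oppr0 !scale0r subr0 addr0 /=.
set e := cos d == -1.
have -> : cos d = (-1) ^+ e.
  rewrite /e; case: cdE => /eqP->; last by rewrite eqxx.
  by rewrite eq_sym eqNr oner_eq0.
by [].
Qed.

Lemma rotNV th th' (e : bool) : (forall x, rot th' x = (-1) ^+ e *: rot th x) ->
  forall x, rot (- th') x = (-1) ^+ e *: rot (- th) x.
Proof.
move=> h x; have rNN a : rot (- th) (rot (- a) x) = rot (- a) (rot (- th) x).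
  by rewrite !rot_rot addrC.
have : rot th' (rot (- th') x) = x by rewrite rot_rot subrr rot0.
rewrite h => /(congr1 (fun y => (-1) ^+ e *: rot (- th) y)) <-.
case: e {h} => /=; rewrite ?expr1 ?expr0 ?scaleN1r ?scale1r ?rotN ?opprK.
  by rewrite rotK.
by rewrite rotK.
Qed.

Lemma frameP t th u v (x := Mpt t th u v) : V2 u v ->
  V2 (frame t x).1.2 (frame t x).2 /\
  x = Mpt t (frame t x).1.1 (frame t x).1.2 (frame t x).2.
Proof.
move=> uv.
pose S := [set f : R * 'rV[R]_l * 'rV[R]_l |
  V2 f.1.2 f.2 /\ x = Mpt t f.1.1 f.1.2 f.2].
by apply: (@getPex _ S); exists (th, u, v).
Qed.

Lemma perp_partN u v w : perp_part u v (- w) = - perp_part u v w.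
Proof.
by rewrite /perp_part !rdotE; apply/rowP => i; rewrite !mxE; ring.
Qed.

Lemma perp_part_opp u v w : perp_part (- u) (- v) w = perp_part u v w.
Proof.
by rewrite /perp_part !rdotE; apply/rowP => i; rewrite !mxE; ring.
Qed.

Lemma pairN (a b : 'rV[R]_l) : (- a, - b) = - ((a, b) : Cvec R l).
Proof. by []. Qed.

Section Frame.
Context (t th th' : R) (u v u' v' : 'rV[R]_l) (e : bool).
Context (u'E : u' = (-1) ^+ e *: u) (v'E : v' = (-1) ^+ e *: v).
Context (rotE' : forall x, rot th' x = (-1) ^+ e *: rot th x).

Lemma X1_frame : X1 th' u' v' = X1 th u v.
Proof.
rewrite /X1 rotE' u'E v'E; case: e => /=; rewrite ?expr1 ?scaleN1r ?scale1r //.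
by rewrite pairN rotN opprK.
Qed.

Lemma X3_frame : X3 th' u' v' = X3 th u v.
Proof.
rewrite /X3 rotE' u'E v'E; case: e => /=; rewrite ?expr1 ?scaleN1r ?scale1r //.
by rewrite pairN rotN opprK.
Qed.

Lemma P2_frame x : P2 th' u' v' x = P2 th u v x.
Proof.
rewrite /P2 (rotNV rotE') rotE' u'E v'E; case: e => /=;
  rewrite ?expr1 ?scaleN1r ?scale1r // perp_part_opp perp_partN.
by rewrite -[X in (_, X)]oppr0 pairN rotN opprK.
Qed.

Lemma P4_frame x : P4 th' u' v' x = P4 th u v x.
Proof.
rewrite /P4 (rotNV rotE') rotE' u'E v'E; case: e => /=;
  rewrite ?expr1 ?scaleN1r ?scale1r // perp_part_opp perp_partN.
by rewrite -[X in (_, X)]oppr0 pairN rotN opprK.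
Qed.

Lemma J_at_frame x : J_at t th' u' v' x = J_at t th u v x.
Proof. by rewrite /J_at X1_frame X3_frame P2_frame P4_frame. Qed.

Lemma ds2_at_frame x y : ds2_at t th' u' v' x y = ds2_at t th u v x y.
Proof.
by rewrite /ds2_at /P1 /P3 X1_frame X3_frame !P2_frame !P4_frame.
Qed.

End Frame.

Lemma J_Mpt t th u v X : 0 < t < pi / 4 -> V2 u v ->
  J t (Mpt t th u v) X = J_at t th u v X.
Proof.
move=> t4 uv; rewrite /J; have := frameP t th uv.
case: (frame _ _) => -[th' u'] v' /= [uv' E].
by have [e [uE vE] rE] := Mpt_inj t4 uv uv' E; apply: J_at_frame uE vE rE _.
Qed.

Lemma ds2_Mpt t th u v X Y : 0 < t < pi / 4 -> V2 u v ->
  ds2 t (Mpt t th u v) X Y = ds2_at t th u v X Y.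
Proof.
move=> t4 uv; rewrite /ds2; have := frameP t th uv.
case: (frame _ _) => -[th' u'] v' /= [uv' E].
by have [e [uE vE] rE] := Mpt_inj t4 uv uv' E; apply: ds2_at_frame uE vE rE _ _.
Qed.

Section Distributions.
Context (th : R) (u v : 'rV[R]_l) (uv : V2 u v).
Let uu : rdot u u = 1. Proof. by case: uv. Qed.
Let vv : rdot v v = 1. Proof. by case: uv. Qed.
Let uv0 : rdot u v = 0. Proof. by case: uv. Qed.
Let vu0 : rdot v u = 0. Proof. by rewrite rdotC. Qed.

Lemma cdotZl a x y : cdot (a *: x) y = a * cdot x y.
Proof. by rewrite /cdot /= !rdotE mulrDr. Qed.

Lemma cdotZr a x y : cdot x (a *: y) = a * cdot x y.
Proof. by rewrite /cdot /= !rdotE mulrDr. Qed.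

Lemma cdot0l x : cdot 0 x = 0.
Proof. by rewrite /cdot /= !rdotE addr0. Qed.

Lemma cdot0r x : cdot x 0 = 0.
Proof. by rewrite /cdot /= !rdotE addr0. Qed.

Lemma rotZ a x : rot th (a *: x) = a *: rot th x.
Proof.
by rewrite !rotE /=; congr pair; apply/rowP => i; rewrite !mxE; ring.
Qed.

Lemma sqrt2V : (Num.sqrt 2 : R)^-1 * ((Num.sqrt 2)^-1 * 2) = 1.
Proof. by rewrite mulrA -invfM -expr2 sqr_sqrtr ?ler0n // mulVf // pnatr_eq0. Qed.

Lemma cdot_X1X1 : cdot (X1 th u v) (X1 th u v) = 1.
Proof.
rewrite /X1 cdotZl cdotZr cdot_rot /cdot /= !rdotE uu vv opprK.
exact: sqrt2V.
Qed.

Lemma cdot_X3X3 : cdot (X3 th u v) (X3 th u v) = 1.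
Proof. by rewrite /X3 cdotZl cdotZr cdot_rot /cdot /= uu vv; exact: sqrt2V. Qed.

Lemma cdot_X1X3 : cdot (X1 th u v) (X3 th u v) = 0.
Proof.
by rewrite /X1 /X3 cdotZl cdotZr cdot_rot /cdot /= !rdotE uu vv subrr !mulr0.
Qed.

Lemma cdot_X3X1 : cdot (X3 th u v) (X1 th u v) = 0.
Proof.
by rewrite /X1 /X3 cdotZl cdotZr cdot_rot /cdot /= !rdotE uu vv subrr !mulr0.
Qed.

Lemma D4E w : mulI (rot th (w, 0)) = rot th (0, w).
Proof. by rewrite mulI_rot /mulI /= oppr0. Qed.

Lemma perp_part_u a : perp_part u v (a *: u) = 0.
Proof. by rewrite /perp_part !rdotE uu uv0 mulr1 mulr0 subrr scale0r subrr. Qed.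

Lemma perp_part_v a : perp_part u v (a *: v) = 0.
Proof.
by rewrite /perp_part !rdotE vu0 vv mulr1 mulr0 scale0r subr0 subrr.
Qed.

Lemma perp_part0 : perp_part u v 0 = 0.
Proof. by rewrite -[X in perp_part _ _ X](scale0r u) perp_part_u. Qed.

Lemma perp_part_id w : rdot w u = 0 -> rdot w v = 0 -> perp_part u v w = w.
Proof. by rewrite /perp_part => -> ->; rewrite !scale0r !subr0. Qed.

Lemma rot00 : rot th (0 : Cvec R l) = 0.
Proof. by rewrite -(scale0r 0) rotZ !scale0r. Qed.

Lemma mulI0 : mulI (0 : Cvec R l) = 0.
Proof. by rewrite /mulI /= oppr0. Qed.

Lemma P2_X1 : P2 th u v (X1 th u v) = 0.
Proof. by rewrite /P2 /X1 -rotZ rotK /= perp_part_v rot00. Qed.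

Lemma P2_X3 : P2 th u v (X3 th u v) = 0.
Proof. by rewrite /P2 /X3 -rotZ rotK /= perp_part_v rot00. Qed.

Lemma P4_X1 : P4 th u v (X1 th u v) = 0.
Proof.
by rewrite /P4 /X1 -rotZ rotK /= scalerN -scaleNr perp_part_u rot00 mulI0.
Qed.

Lemma P4_X3 : P4 th u v (X3 th u v) = 0.
Proof. by rewrite /P4 /X3 -rotZ rotK /= perp_part_u rot00 mulI0. Qed.

Lemma P2_D2 x : D2 th u v x -> P2 th u v x = x.
Proof. by case=> w [wu wv ->]; rewrite /P2 rotK /= perp_part_id. Qed.

Lemma P4_D2 x : D2 th u v x -> P4 th u v x = 0.
Proof. by case=> w [wu wv ->]; rewrite /P4 rotK /= perp_part0 rot00 mulI0. Qed.

Lemma P2_D4 x : D4 th u v x -> P2 th u v x = 0.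
Proof. by case=> w [wu wv ->]; rewrite D4E /P2 rotK /= perp_part0 rot00. Qed.

Lemma P4_D4 x : D4 th u v x -> P4 th u v x = x.
Proof. by case=> w [wu wv ->]; rewrite {1}D4E /P4 rotK /= perp_part_id. Qed.

Lemma cdot_D2 x : D2 th u v x -> cdot x (X1 th u v) = 0 /\ cdot x (X3 th u v) = 0.
Proof.
case=> w [wu wv ->]; rewrite /X1 /X3 !cdotZr !cdot_rot /cdot /= !rdotE wv.
by rewrite ?oppr0 !addr0 !mulr0.
Qed.

Lemma cdot_D4 x : D4 th u v x -> cdot x (X1 th u v) = 0 /\ cdot x (X3 th u v) = 0.
Proof.
case=> w [wu wv ->]; rewrite D4E /X1 /X3 !cdotZr !cdot_rot /cdot /= !rdotE wu.
by rewrite ?oppr0 !addr0 !mulr0.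
Qed.

Context (t : R) (t4 : 0 < t < pi / 4).
Local Notation x := (Mpt t th u v).

Lemma J_X1 : J t x (X1 th u v) = - cot (t + pi / 4) *: X3 th u v.
Proof.
rewrite J_Mpt // /J_at cdot_X1X1 cdot_X1X3 P2_X1 P4_X1 mulI0.
by rewrite mulr1 mulr0 !scale0r !scaler0 !addr0.
Qed.

Lemma J_X3 : J t x (X3 th u v) = - cot (t + 3 * pi / 4) *: X1 th u v.
Proof.
rewrite J_Mpt // /J_at cdot_X3X3 cdot_X3X1 P2_X3 P4_X3 mulI0.
by rewrite mulr1 mulr0 !scale0r !scaler0 !addr0 add0r.
Qed.

Lemma J_D2 X : D2 th u v X -> J t x X = - cot (t + pi / 2) *: mulI X.
Proof.
move=> XD; have [h1 h3] := cdot_D2 XD.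
rewrite J_Mpt // /J_at h1 h3 P2_D2 // P4_D2 // mulI0.
by rewrite !mulr0 !scale0r !scaler0 !addr0 !add0r.
Qed.

Lemma J_D4 X : D4 th u v X -> J t x X = cot t *: mulI X.
Proof.
move=> XD; have [h1 h3] := cdot_D4 XD.
rewrite J_Mpt // /J_at h1 h3 P2_D4 // P4_D4 // mulI0.
by rewrite !mulr0 !scale0r !scaler0 !add0r.
Qed.

Lemma ds2_X1 X : ds2 t x (X1 th u v) X = c1 t ^- 2 * cdot (X1 th u v) X.
Proof.
rewrite ds2_Mpt // /ds2_at {1}/P1 {1}/P3 cdot_X1X1 cdot_X1X3 P2_X1 P4_X1.
rewrite scale1r scale0r !cdot0l !mulr0 !addr0 /P1 cdotZr cdot_X1X1 mulr1.
by rewrite /cdot (rdotC X.1) (rdotC X.2).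
Qed.

Lemma ds2_X3 X : ds2 t x (X3 th u v) X = c3 t ^- 2 * cdot (X3 th u v) X.
Proof.
rewrite ds2_Mpt // /ds2_at {1}/P1 {1}/P3 cdot_X3X1 cdot_X3X3 P2_X3 P4_X3.
rewrite scale1r scale0r !cdot0l !mulr0 !addr0 add0r /P3 cdotZr cdot_X3X3 mulr1.
by rewrite /cdot (rdotC X.1) (rdotC X.2).
Qed.

Lemma rdot_perp w (z : 'rV[R]_l) : rdot w u = 0 -> rdot w v = 0 ->
  rdot w (perp_part u v z) = rdot w z.
Proof. by rewrite /perp_part !rdotE => -> ->; rewrite !mulr0 !oppr0 !addr0. Qed.

Lemma cdot_rotN y z : cdot (rot th y) z = cdot y (rot (- th) z).
Proof. by rewrite -(cdot_rot (- th)) rotK. Qed.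

Lemma ds2_D2 X Y : D2 th u v X -> ds2 t x X Y = c2 t ^- 2 * cdot X Y.
Proof.
move=> XD; have [h1 h3] := cdot_D2 XD.
rewrite ds2_Mpt // /ds2_at {1}/P1 {1}/P3 h1 h3 P2_D2 // P4_D2 //.
rewrite !scale0r !cdot0l !mulr0 !addr0 add0r; congr (_ * _).
case: XD => w [wu wv ->]; rewrite /P2 cdot_rot cdot_rotN /cdot /= !rdot0l.
by rewrite rdot_perp.
Qed.

Lemma ds2_D4 X Y : D4 th u v X -> ds2 t x X Y = c4 t ^- 2 * cdot X Y.
Proof.
move=> XD; have [h1 h3] := cdot_D4 XD.
rewrite ds2_Mpt // /ds2_at {1}/P1 {1}/P3 h1 h3 P2_D4 // P4_D4 //.
rewrite !scale0r !cdot0l !mulr0 !add0r; congr (_ * _).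
case: XD => w [wu wv ->]; rewrite !D4E /P4 D4E cdot_rot cdot_rotN /cdot /= !rdot0l.
by rewrite rdot_perp.
Qed.

End Distributions.

End Calculus.

(* Main.v *)
Require Import Defs.
From HB Require Import structures.
From mathcomp Require Import all_boot all_order all_algebra all_fingroup.
From mathcomp Require Import all_classical all_reals all_analysis.
From mathcomp Require Import ring lra zify.

Set Implicit Arguments.
Unset Strict Implicit.
Unset Printing Implicit Defensive.

Import Defs.
Import Order.TTheory GRing.Theory Num.Theory numFieldNormedType.Exports.
Local Open Scope classical_set_scope.
Local Open Scope ring_scope.

(** Write m for the exponent in the balanced condition, so that the real
    dimension of M_t is 2m + 2. At x = e^(i th) (cos t u + i sin t v) a tangent
    vector is determined by the velocities (a, du, dv) of (th, u, v). Let phi be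
    the 1-form <du, v>. In these terms the Kaehler form of the metric is
      omega = 2 dth /\ phi - d phi,
    whatever t is: the part of omega carried by X1, X3 is the first summand, and
    the part carried by the distributions D2, D4 is the restriction of the
    standard symplectic form of C^l up to a constant, which is exact
    (kahler_rot, kahler_velocity). Hence d omega = - 2 dth /\ d phi and
      d (omega^m) = m (d omega) /\ omega^(m-1)
    is a nonzero multiple of dth /\ (d phi)^m. The form d phi is the pullback of
    a symplectic form of the Grassmannian of oriented planes, so this does not
    vanish once m >= 1.

    To make this a finite computation, M_t is parametrised rationally in (u, v):
    u is the inverse stereographic image of x in R^(l-1), and v is the image of a
    unit vector y of R^(l-1), itself the inverse stereographic image of some z in
    R^(l-2), under the differential of the stereographic parametrisation rescaled
    to an isometry. Then phi = conf x * <dx, y> (rdot_Dstereo_tang) with conf the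
    conformal factor, and omega together with its first derivatives at the
    origin can be read off (omega_origin, D_omega_origin): on the coordinate
    fields along th, x_1, z_1, ..., x_m, z_m it is a standard symplectic matrix
    in the pairs (x_a, z_a), and the only derivatives that matter are those of
    omega (th, x_a) along z_a.

    The m-th wedge power is a signed sum, over permutations s, of products of
    values of omega on the pairs (s (2k), s (2k+1)) (wedge_expE). Substituting
    this in the exterior derivative gives a signed sum over permutations of all
    2m + 1 labels. A permutation that sends pairs to pairs has the sign of the
    number of pairs that it reverses (pair_term_ge0), so no two terms cancel
    (dterm_ge0), and one of them is positive (term_gt0). *)

(** * Wedge powers of a 2-form *)
Lemma pair_pos_subproof m (k : 'I_m) (b : 'I_2) : (k.*2 + b < m.*2)%N.
Proof. by have := ltn_ord k; have := ltn_ord b; lia. Qed.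

Definition pair_pos m (k : 'I_m) (b : 'I_2) : 'I_m.*2 := Ordinal (pair_pos_subproof k b).

(** Unfolding the recursion gives a sum over pairs (s, s') of a permutation of
    all the arguments and one of the last ones. Extended by the identity on the
    first two arguments, s' is absorbed into s by translation in the symmetric
    group, so that each s' contributes the same sum; this cancels the factorial
    in the normalisation of the wedge product. *)
Lemma wedge_expE (R : realType) (V : Type) (w : form R V 2) m (v : 'I_m.*2 -> V) :
  wedge_exp w m v = (2 ^+ m)^-1 *
    \sum_(s : 'S_(m.*2)) (-1) ^+ s * \prod_(k < m) w (fun b => v (s (pair_pos k b))).
Proof.
elim: m v => [|m IH] v.
  rewrite /= expr0 invr1 mul1r (big_pred1 1%g) => [|s]; last first.
    by apply/esym/eqP/permP => -[].
  by rewrite odd_perm1 expr0 big_ord0 mulr1.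
pose L (s : 'S_(m.*2)) : 'S_(2 + m.*2) := lift_perm ord0 ord0 (lift_perm ord0 ord0 s).
have Lr s j : L s (rshift 2 j) = rshift 2 (s j).
  have E (i : 'I_m.*2) : rshift 2 i = lift ord0 (lift ord0 i) by apply: val_inj.
  by rewrite !E /L !lift_perm_lift.
have Ll s b : L s (lshift m.*2 b) = lshift m.*2 b.
  case: b => -[|[|//]] lb.
    have -> : lshift m.*2 (Ordinal lb) = ord0 by apply: val_inj.
    by rewrite /L lift_perm_id.
  have -> : lshift m.*2 (Ordinal lb) = lift ord0 ord0 by apply: val_inj.
  by rewrite /L lift_perm_lift lift_perm_id.
have Ls s : odd_perm (L s) = odd_perm s by rewrite /L !odd_lift_perm.
pose T (s : 'S_(m.+1.*2)) : R :=
  (-1) ^+ s * \prod_(k < m.+1) w (fun b => v (s (pair_pos k b))).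
have TE s s' : T (L s' * s)%g = (-1) ^+ s' *
    ((-1) ^+ s * w (fun b => v (s (lshift _ b))) *
     \prod_(k < m) w (fun b => v (s (rshift 2 (s' (pair_pos k b)))))).
  rewrite /T big_ord_recl odd_permM signr_addb Ls -!mulrA; congr (_ * (_ * (_ * _))).
    congr w; apply: funext => b; rewrite permM -[in RHS](Ll s'); congr (v (s (L _ _))).
    exact: val_inj.
  apply: eq_bigr => k _; congr w; apply: funext => b; rewrite permM -Lr.
  by congr (v (s (L _ _))); apply: val_inj.
rewrite /= /wedge.
transitivity ((2`! * (m.*2)`!)%:R^-1 *
  ((2 ^+ m)^-1 * \sum_(s' : 'S_(m.*2)) \sum_s T (L s' * s)%g)).
  congr (_ * _); rewrite exchange_big mulr_sumr; apply: eq_bigr => s _.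
  rewrite IH mulrCA; congr (_ * _); rewrite mulr_sumr; apply: eq_bigr => s' _.
  by rewrite TE mulrCA.
have TR s' : \sum_s T (L s' * s)%g = \sum_s T s.
  by rewrite [RHS](reindex_inj (mulgI (L s'))).
rewrite (eq_bigr _ (fun s' _ => TR s')).
rewrite sumr_const card_Sn -[X in _ = _ * X]/(\sum_s T s) -mulr_natl natrM exprS.
rewrite -[2`!%:R]/(2 : R).
have h1 : (m.*2`!)%:R != 0 :> R by rewrite pnatr_eq0 -lt0n fact_gt0.
have h3 : (2 ^+ m : R) != 0 by rewrite expf_neq0 // pnatr_eq0.
by move: (\sum_s T s) => Z; field; rewrite h1 h3.
Qed.

(** * Signs of permutations that preserve a pairing *)

(** The matrix of the standard symplectic form with Darboux basis
    e 1, f 1, ..., e n, f n; any further element of T is in its kernel. *)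
Definition pairing (R : realType) (T : eqType) n (e f : 'I_n -> T) (x y : T) : R :=
  \sum_(a < n) (((x == e a) && (y == f a))%:R - ((x == f a) && (y == e a))%:R).

Section PairSign.
Context (R : realType) (T : finType) (n : nat) (e f : 'I_n -> T).
Hypotheses (ei : injective e) (fi : injective f) (ef : forall a b, e a != f b).
Local Notation eps := (@pairing R T n e f).

Lemma pairingC x y : eps x y = - eps y x.
Proof.
rewrite -sumrN; apply: eq_bigr => a _; rewrite opprB.
by rewrite [(y == _) && _]andbC [(y == e _) && _]andbC.
Qed.

Lemma pairing_ef a : eps (e a) (f a) = 1.
Proof.
rewrite /pairing (bigD1 a) //= !eqxx (negPf (ef a a)) subr0 big1 ?addr0 // => b ba.
by rewrite (inj_eq ei) eq_sym (negPf ba) (negPf (ef _ _)) subrr.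
Qed.

Lemma pairing_neq0 x y : eps x y != 0 ->
  exists a, (x = e a /\ y = f a) \/ (x = f a /\ y = e a).
Proof.
move=> h; suff /existsP[a /orP[/andP[/eqP-> /eqP->]|/andP[/eqP-> /eqP->]]] :
    [exists a, (x == e a) && (y == f a) || (x == f a) && (y == e a)].
- by exists a; left.
- by exists a; right.
apply: contraNT h; rewrite negb_exists => /forallP h.
rewrite /pairing big1 // => a _; have := h a; rewrite negb_or => /andP[/negPf-> /negPf->].
by rewrite subrr.
Qed.

Definition pair_term (s : {perm T}) : R :=
  (-1) ^+ s * \prod_(k < n) eps (s (e k)) (s (f k)).

(** Exchanging the arguments e k and f k changes both the sign of the
    permutation and that of one factor. *)
Lemma pair_term_flip k s : pair_term (tperm (e k) (f k) * s)%g = pair_term s.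
Proof.
rewrite /pair_term odd_permM odd_tperm ef addTb (bigD1 k) //= [in RHS](bigD1 k) //=.
rewrite !permM tpermL tpermR pairingC mulNr mulrN -mulNr -signrN.
congr (_ * (_ * _)); first by rewrite negbK.
apply: eq_bigr => j jk.
by rewrite !permM !tpermD // ?(inj_eq ei) ?(inj_eq fi) ?ef // 1?eq_sym ?ef // 1?eq_sym.
Qed.

(* The exchange of two pairs is a product of two transpositions, hence even,
   and it preserves the symplectic matrix. *)
Let swap a k : {perm T} := (tperm (e a) (e k) * tperm (f a) (f k))%g.

Lemma swap_e a k b : swap a k (e b) = e (tperm a k b).
Proof.
by rewrite permM -(inj_tperm _ _ _ ei) tpermD // eq_sym.
Qed.

Lemma swap_f a k b : swap a k (f b) = f (tperm a k b).
Proof. by rewrite permM (tpermD (ef _ _) (ef _ _)) -(inj_tperm _ _ _ fi). Qed.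

Lemma pair_term_swap a k s : pair_term (s * swap a k)%g = pair_term s.
Proof.
rewrite /pair_term odd_permM odd_permM !odd_tperm (inj_eq ei) (inj_eq fi) addbb addbF.
congr (_ * _); apply: eq_bigr => j _; rewrite !(permM s).
rewrite {1}/pairing (reindex_inj (@perm_inj _ (tperm a k))); apply: eq_bigr => b _.
by rewrite -!swap_e -!swap_f !(inj_eq perm_inj).
Qed.

(** By flips and exchanges of pairs, which leave the term unchanged, a
    permutation with a nonzero term is brought to the identity, whose term is 1.
    The induction is on the number of pairs that are moved. With one unpaired
    label at most, fixing all the pairs means being the identity. *)
Lemma pair_term_ge0 (o : T) (s : {perm T}) :
  (forall x, x = o \/ exists a, x = e a \/ x = f a) -> 0 <= pair_term s.
Proof.
move=> cover.
pose moved (s : {perm T}) := [set k | ~~ ((s (e k) == e k) && (s (f k) == f k))]%SET.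
have [c] := ubnP #|moved s|; elim: c s => // c IH s sc.
have [s0|s0] := eqVneq (pair_term s) 0; first by rewrite s0.
have [m0|[k]] := set_0Vmem (moved s).
  have fixed k : s (e k) = e k /\ s (f k) = f k.
    have : k \notin moved s by rewrite m0 inE.
    by rewrite inE negbK => /andP[/eqP ? /eqP ?].
  have so : s o = o.
    case: (cover (s o)) => [//|[a [E|E]]].
      by have /perm_inj h := etrans (fixed a).1 (esym E); rewrite E.
    by have /perm_inj h := etrans (fixed a).2 (esym E); rewrite E.
  have s1 : s = 1%g.
    apply/permP => x; rewrite perm1.
    case: (cover x) => [->|[a [->|->]]] //; first exact: (fixed a).1.
    exact: (fixed a).2.
  rewrite /pair_term s1 odd_perm1 expr0 mul1r prodr_ge0 // => a _.
  by rewrite !perm1 pairing_ef.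
move=> km.
have step (s' : {perm T}) a : s' (e k) = e a -> s' (f k) = f a -> moved s' \subset moved s ->
    0 <= pair_term s'.
  move=> sek sfk sub; rewrite -(pair_term_swap a k); apply: IH.
  rewrite -ltnS; apply: leq_trans sc; rewrite ltnS; apply: proper_card.
  apply/properP; split; last first.
    exists k => //; rewrite inE !(permM s') sek sfk swap_e swap_f tpermL.
    by rewrite !eqxx.
  apply/fintype.subsetP => j; apply: contraLR => js.
  have jk : j != k by apply: contraNneq js => ->.
  have : j \notin moved s' by apply: contra js; apply: (fintype.subsetP sub).
  rewrite !inE !negbK !(permM s') => /andP[/eqP sej /eqP sfj].
  have ja : j != a.
    apply: contraNneq jk => ja.
    by have /perm_inj/ei -> : s' (e k) = s' (e j) by rewrite sek sej ja.
  rewrite sej sfj swap_e swap_f tpermD ?eqxx //; by rewrite eq_sym.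
have : eps (s (e k)) (s (f k)) != 0.
  by apply: contraNneq s0 => h; rewrite /pair_term (bigD1 k) //= h mul0r mulr0.
move=> /pairing_neq0[a [[h1 h2]|[h1 h2]]]; first exact: (step s a).
rewrite -(pair_term_flip k); apply: (step _ a); rewrite ?permM ?tpermL ?tpermR //.
apply/fintype.subsetP => j; have [->//|jk] := eqVneq j k.
rewrite !inE !permM !tpermD //;
  by rewrite ?(inj_eq ei) ?(inj_eq fi) ?ef // 1?eq_sym ?ef // 1?eq_sym.
Qed.

End PairSign.

(** * Positivity of the terms of the exterior derivative *)

(** W is the matrix of a 2-form in a frame whose labels are o and the pairs
    (e a, f a), and D x y z stands for the derivative along x of its (y, z)
    entry. *)
Section DerivedTerm.
Context (R : realType) (T : finType) (n : nat) (o : T) (e f : 'I_n -> T).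
Hypotheses (ei : injective e) (fi : injective f) (ef : forall a b, e a != f b).
Hypotheses (o_e : forall a, o != e a) (o_f : forall a, o != f a).
Hypothesis cover : forall x, x = o \/ exists a, x = e a \/ x = f a.
Local Notation eps := (pairing R e f).

Definition matched (x y : T) : R := \sum_a ((x == e a) && (y == f a))%:R.

Lemma matched_ge0 x y : 0 <= matched x y.
Proof. by apply: sumr_ge0. Qed.

Lemma matched_pairing x y : matched x y = matched x y * eps x y.
Proof.
have [->|h] := eqVneq (matched x y) 0; first by rewrite mul0r.
suff [a [-> ->]] : exists a, x = e a /\ y = f a.
  by rewrite (pairing_ef _ ei ef) mulr1.
have /existsP[a /andP[/eqP-> /eqP->]] : [exists a, (x == e a) && (y == f a)].
  apply: contraNT h; rewrite negb_exists => /forallP h.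
  by rewrite /matched big1 // => a _; rewrite (negPf (h a)).
by exists a.
Qed.

Lemma pairing_o y : eps o y = 0.
Proof.
have [->//|/pairing_neq0[a [[/eqP E _]|[/eqP E _]]]] := eqVneq (eps o y) 0.
  by rewrite (negPf (o_e a)) in E.
by rewrite (negPf (o_f a)) in E.
Qed.

Context (W : T -> T -> R) (D : T -> T -> T -> R) (c c' : R).
Hypotheses (c0 : 0 <= c) (c'0 : 0 <= c').
Hypothesis WE : forall x y, W x y = c * eps x y.
Hypothesis D_anti : forall x y z, D x z y = - D x y z.
Hypothesis D_o : forall y z, D o y z = 0.
Hypothesis DE : forall x y, D x o y = c' * matched y x.

Definition dterm (s : {perm T}) (k : 'I_n) : R :=
  (-1) ^+ s * (D (s o) (s (e k)) (s (f k)) * \prod_(a < n | a != k) W (s (e a)) (s (f a))).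

Lemma dterm_flip (s : {perm T}) k : dterm (tperm (e k) (f k) * s)%g k = dterm s k.
Proof.
rewrite /dterm odd_permM odd_tperm ef addTb signrN !permM tpermL tpermR.
have -> : tperm (e k) (f k) o = o by rewrite tpermD // eq_sym.
rewrite D_anti !mulNr mulrN opprK; congr (_ * (_ * _)); apply: eq_bigr => a ak.
by rewrite !permM !tpermD // ?(inj_eq ei) ?(inj_eq fi) ?ef // 1?eq_sym ?ef // 1?eq_sym.
Qed.

(** If the differentiated entry is that of (e a, o), taken along f a, exchanging
    the values of s at o and f k restores the pair (e a, f a): the term becomes a
    nonnegative multiple of a term of the undifferentiated form, the change of sign
    being that of D under the exchange of its last two labels. *)
Lemma dterm_ge0_f (s : {perm T}) k : s (f k) = o -> 0 <= dterm s k.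
Proof.
move=> sf.
pose s' : {perm T} := (tperm o (f k) * s)%g.
have odd_s' : odd_perm s' = ~~ odd_perm s by rewrite odd_permM odd_tperm o_f.
have s'e a : s' (e a) = s (e a) by rewrite permM tpermD // eq_sym.
have s'f a : a != k -> s' (f a) = s (f a).
  by move=> ak; rewrite permM tpermD // (inj_eq fi) eq_sym.
have s'fk : s' (f k) = s o by rewrite permM tpermR.
clearbody s'.
have -> : dterm s k = c' * c ^+ #|[pred a | a != k]| * matched (s (e k)) (s o) *
    pair_term R e f s'.
  rewrite /dterm sf D_anti DE /pair_term [in RHS](bigD1 k) //= odd_s' signrN.
  rewrite s'e s'fk [in LHS]matched_pairing.
  have -> : \prod_(a < n | a != k) W (s (e a)) (s (f a)) =
      c ^+ #|[pred a | a != k]| * \prod_(a < n | a != k) eps (s' (e a)) (s' (f a)).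
    rewrite -prodr_const -big_split; apply: eq_bigr => a ak.
    by rewrite WE s'e s'f.
  set P := \prod_(a < n | a != k) eps _ _; set m := matched _ _; set x := eps _ _.
  by move: P m x (c ^+ _) ((-1) ^+ s) => P m x C sg; ring.
apply: mulr_ge0; last exact: (pair_term_ge0 R ei fi ef _ cover).
by rewrite !mulr_ge0 ?exprn_ge0 // matched_ge0.
Qed.

(** The label o must occur in the differentiated factor, since every entry of W
    with label o vanishes; it cannot be the direction of derivation either, so
    that, after a flip, the preceding case applies. *)
Lemma dterm_ge0 (s : {perm T}) k : 0 <= dterm s k.
Proof.
have [s0|s0] := eqVneq (s o) o; first by rewrite /dterm s0 D_o mul0r mulr0.
have [sf|sf] := eqVneq (s (f k)) o; first exact: dterm_ge0_f.
have [se|se] := eqVneq (s (e k)) o.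
  by rewrite -dterm_flip; apply: dterm_ge0_f; rewrite permM tpermR.
suff [a ak az] : exists2 a, a != k & W (s (e a)) (s (f a)) = 0.
  by rewrite /dterm (bigD1 a) //= az mul0r !mulr0.
have sE : s (s^-1%g o) = o by rewrite permKV.
have [E|[a [E|E]]] := cover (s^-1%g o); rewrite E in sE.
- by rewrite sE eqxx in s0.
- exists a; first by apply: contraNneq se => <-; rewrite sE.
  by rewrite sE WE pairing_o mulr0.
- exists a; first by apply: contraNneq sf => <-; rewrite sE.
  by rewrite sE WE (pairingC R) pairing_o oppr0 mulr0.
Qed.

End DerivedTerm.

(** * Elementary functions *)

(** A class of functions closed under partial derivatives is made of smooth
    functions; an inductively defined class makes the smoothness of a
    parametrisation and the existence of all the derivatives that occur in the
    exterior derivative a matter of syntax. *)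
Section Elementary.
Context (R : realType) (d : nat).
Local Notation V := 'rV[R]_d.
Implicit Types (f g : V -> R) (p q h : V).

Inductive elementary : (V -> R) -> Prop :=
| elem_cst c : elementary (fun=> c)
| elem_coord i : elementary (fun q => q 0 i)
| elem_add f g : elementary f -> elementary g -> elementary (fun q => f q + g q)
| elem_mul f g : elementary f -> elementary g -> elementary (fun q => f q * g q)
| elem_inv f : elementary f -> (forall q, f q != 0) -> elementary (fun q => (f q)^-1)
| elem_cos f : elementary f -> elementary (fun q => cos (f q))
| elem_sin f : elementary f -> elementary (fun q => sin (f q)).

Lemma elem_differentiable f q : elementary f -> differentiable f q.
Proof.
elim=> {f} [c|i|f g _ df _ dg|f g _ df _ dg|f _ df f0|f _ df|f _ df].
- exact: differentiable_cst.
- exact: differentiable_coord.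
- exact: (differentiableD df dg).
- exact: (differentiableM df dg).
- exact: (differentiableV df (f0 q)).
- apply: (differentiable_comp df); apply/derivable1_diffP; exact: derivable_cos.
- apply: (differentiable_comp df); apply/derivable1_diffP; exact: derivable_sin.
Qed.

Lemma elem_derivable f q h : elementary f -> derivable f q h.
Proof. by move=> /(@elem_differentiable _ q)/diff_derivable. Qed.

Lemma D_cst c q h : 'D_h (fun=> c : R) q = 0.
Proof. exact: derive_cst. Qed.

Lemma D_coord i q h : 'D_h (fun p : V => p 0 i) q = h 0 i.
Proof.
rewrite deriveE; last exact: differentiable_coord.
pose c (p : V) : R := p 0 i.
have lc : linear c by move=> a x y; rewrite /c !mxE.
pose cL : {linear V -> R} := HB.pack c (GRing.isLinear.Build _ _ _ _ c lc).
by rewrite -[fun p => _]/(cL : V -> R) diff_lin //; exact: coord_continuous.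
Qed.

Lemma D_add f g q h : elementary f -> elementary g ->
  'D_h (fun p => f p + g p) q = 'D_h f q + 'D_h g q.
Proof.
move=> /(@elem_derivable _ q h) df /(@elem_derivable _ q h) dg.
by rewrite -deriveD.
Qed.

Lemma D_mul f g q h : elementary f -> elementary g ->
  'D_h (fun p => f p * g p) q = f q * 'D_h g q + g q * 'D_h f q.
Proof.
move=> /(@elem_derivable _ q h) df /(@elem_derivable _ q h) dg.
by rewrite -[LHS]/('D_h (f * g) q) deriveM.
Qed.

Lemma D_inv f q h : elementary f -> f q != 0 ->
  'D_h (fun p => (f p)^-1) q = - (f q)^-1 ^+ 2 * 'D_h f q.
Proof.
move=> /(@elem_derivable _ q h) df f0.
by rewrite deriveV // exprVn.
Qed.

Lemma D_comp (k : R -> R) f q h : derivable k (f q) 1 -> elementary f ->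
  'D_h (fun p => k (f p)) q = (k^`())%classic (f q) * 'D_h f q.
Proof.
move=> dk /(@elem_differentiable _ q) df; have dk' := dk.
move/derivable1_diffP in dk'.
rewrite -[LHS]/('D_h (k \o f) q) deriveE; last exact: differentiable_comp.
by rewrite diff_comp //= deriv1E // -deriveE // mulrC.
Qed.

Lemma D_cos f q h : elementary f -> 'D_h (fun p => cos (f p)) q = - sin (f q) * 'D_h f q.
Proof.
move=> ef; rewrite D_comp //; congr (_ * _).
by rewrite derive1E; apply: derive_val.
Qed.

Lemma D_sin f q h : elementary f -> 'D_h (fun p => sin (f p)) q = cos (f q) * 'D_h f q.
Proof.
move=> ef; rewrite D_comp //; congr (_ * _).
by rewrite derive1E; apply: derive_val.
Qed.

Lemma elem_derive f h : elementary f -> elementary (fun q => 'D_h f q).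
Proof.
elim=> {f} [c|i|f g ef Df eg Dg|f g ef Df eg Dg|f ef Df f0|f ef Df|f ef Df].
- by under eq_fun do rewrite D_cst; exact: elem_cst.
- by under eq_fun do rewrite D_coord; exact: elem_cst.
- under eq_fun do rewrite D_add //.
  exact: elem_add.
- under eq_fun do rewrite D_mul //.
  by apply: elem_add; apply: elem_mul.
- under eq_fun do rewrite D_inv // -mulN1r -mulrA expr2 -mulrA.
  by do ?[apply: elem_mul|apply: elem_inv|apply: elem_cst].
- under eq_fun do rewrite D_cos // -mulN1r -mulrA.
  by do ?[apply: elem_mul|apply: elem_sin|apply: elem_cst].
- under eq_fun do rewrite D_sin //.
  by do ?[apply: elem_mul|apply: elem_cos|apply: elem_cst].
Qed.

Lemma elem_opp f : elementary f -> elementary (fun q => - f q).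
Proof.
move=> ef; under eq_fun do rewrite -mulN1r.
by apply: elem_mul => //; exact: elem_cst.
Qed.

Lemma elem_sub f g : elementary f -> elementary g -> elementary (fun q => f q - g q).
Proof. by move=> ef eg; apply: elem_add => //; exact: elem_opp. Qed.

Lemma D_opp f q h : elementary f -> 'D_h (fun p => - f p) q = - 'D_h f q.
Proof. by move=> ef; rewrite deriveN //; exact: elem_derivable. Qed.

Lemma D_sub f g q h : elementary f -> elementary g ->
  'D_h (fun p => f p - g p) q = 'D_h f q - 'D_h g q.
Proof. by move=> ef eg; rewrite D_add ?D_opp //; exact: elem_opp. Qed.

Section BigSum.
Context (I : Type) (f : I -> V -> R).
Hypothesis ef : forall i, elementary (f i).

Lemma elem_sum (r : seq I) : elementary (fun q => \sum_(i <- r) f i q).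
Proof.
elim: r => [|i r IH].
  by under eq_fun do rewrite big_nil; exact: elem_cst.
by under eq_fun do rewrite big_cons; exact: elem_add.
Qed.

Lemma D_sum (r : seq I) q h : 'D_h (fun q => \sum_(i <- r) f i q) q = \sum_(i <- r) 'D_h (f i) q.
Proof.
elim: r => [|i r IH].
  by under eq_fun do rewrite big_nil; rewrite D_cst big_nil.
by under eq_fun do rewrite big_cons; rewrite D_add ?IH ?big_cons //; exact: elem_sum.
Qed.

End BigSum.

Lemma elem_prod n (f : 'I_n -> V -> R) : (forall i, elementary (f i)) ->
  elementary (fun q => \prod_i f i q).
Proof.
elim: n f => [|n IH] f ef.
  by under eq_fun do rewrite big_ord0; exact: elem_cst.
by under eq_fun do rewrite big_ord_recl; apply: elem_mul => //; apply: IH.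
Qed.

Lemma D_prod n (f : 'I_n -> V -> R) q h : (forall i, elementary (f i)) ->
  'D_h (fun q => \prod_i f i q) q = \sum_i 'D_h (f i) q * \prod_(j < n | j != i) f j q.
Proof.
elim: n f => [|n IH] f ef.
  by under eq_fun do rewrite big_ord0; rewrite D_cst big_ord0.
under eq_fun do rewrite big_ord_recl.
rewrite D_mul //; last exact: elem_prod.
rewrite (IH (fun i => f (lift ord0 i))) // big_ord_recl addrC; congr (_ + _).
  by rewrite mulrC [X in _ = _ * X]big_mkcond big_ord_recl /= mul1r.
rewrite mulr_sumr; apply: eq_bigr => i _; rewrite mulrCA; congr (_ * _).
by rewrite [RHS]big_mkcond big_ord_recl /= -big_mkcond.
Qed.

Section Vector.
Context (W : normedModType R) (n : nat) (E : 'I_n -> W).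

Lemma elem_vec_differentiable (f : 'I_n -> V -> R) q :
  (forall i, elementary (f i)) -> differentiable (fun p => \sum_i f i p *: E i) q.
Proof.
move=> ef; rewrite -fct_sumE; apply: differentiable_sum => i.
by apply: differentiableZl; exact: elem_differentiable.
Qed.

Lemma D_vec (f : 'I_n -> V -> R) q h : (forall i, elementary (f i)) ->
  'D_h (fun p => \sum_i f i p *: E i) q = \sum_i 'D_h (f i) q *: E i.
Proof.
move=> ef; have df i : differentiable (fun p => f i p *: E i) q.
  by apply: differentiableZl; exact: elem_differentiable.
rewrite -fct_sumE derive_sum => [|i]; last exact: diff_derivable.
apply: eq_bigr => i _; rewrite deriveE // diffZl ?deriveE //; exact: elem_differentiable.
Qed.

(** The induction on the order of differentiability goes through because the
    partial derivatives have the same form, with elementary coefficients. *)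
Lemma elem_vec_smooth (f : 'I_n -> V -> R) : (forall i, elementary (f i)) ->
  smooth_on setT (fun q => \sum_i f i q *: E i).
Proof.
move=> + k; elim: k f => [|k IH] f ef /=.
  by move=> q _; apply: differentiable_continuous; exact: elem_vec_differentiable.
split=> [q _|i]; first exact: elem_vec_differentiable.
under eq_fun do rewrite D_vec //.
by apply: IH => j; exact: elem_derive.
Qed.

End Vector.

Definition invariant_along (e : V) (f : V -> R) := forall q (a : R), f (q + a *: e) = f q.

Lemma invariant_derive e f h : invariant_along e f -> invariant_along e (fun q => 'D_h f q).
Proof.
move=> inv q a; rewrite /derive.
set F := (X in lim (X @ _)%classic); set G := (X in _ = lim (X @ _)%classic).
suff -> : F = G by []; apply: funext => b; rewrite /F /G /=.
by rewrite addrA !inv.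
Qed.

Lemma derive_invariant e f q : invariant_along e f -> 'D_e f q = 0.
Proof.
move=> inv.
rewrite -[RHS](derive_cst (f q) q e) /derive.
set F := (X in lim (X @ _)%classic); set G := (X in _ = lim (X @ _)%classic).
suff -> : F = G by []; apply: funext => b; rewrite /F /G /=.
by rewrite (addrC (_ *: e)) inv.
Qed.

End Elementary.

(** * The Kaehler form of M_t *)

Section Cotangents.
Context (R : realType).
Implicit Types t : R.

Lemma cos_sin_pi4 : cos (pi / 4) = sin (pi / 4) :> R.
Proof.
by rewrite -cosN -sinDpihalf; congr sin; lra.
Qed.

Lemma sin_pi4_neq0 : sin (pi / 4) != 0 :> R.
Proof.
have p0 := pi_gt0 R.
by rewrite lt0r_neq0 // sin_gt0_pi //; apply/andP; split; lra.
Qed.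

Lemma cosDpi4 t : cos (t + pi / 4) = sin (pi / 4) * (cos t - sin t).
Proof. by rewrite cosD cos_sin_pi4; ring. Qed.

Lemma sinDpi4 t : sin (t + pi / 4) = sin (pi / 4) * (cos t + sin t).
Proof. by rewrite sinD cos_sin_pi4; ring. Qed.

Lemma cot_quarter t : cot (t + pi / 4) = (cos t - sin t) / (cos t + sin t).
Proof. by rewrite /cot cosDpi4 sinDpi4 -mulf_div divff ?mul1r // sin_pi4_neq0. Qed.

Lemma cot_three_quarter t :
  cot (t + 3 * pi / 4) = - ((cos t + sin t) / (cos t - sin t)).
Proof.
have -> : t + 3 * pi / 4 = (t + pi / 4) + pi / 2 by field.
rewrite /cot cosDpihalf sinDpihalf cosDpi4 sinDpi4 mulNr -mulf_div.
by rewrite divff ?mul1r // sin_pi4_neq0.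
Qed.

Lemma cot_half t : cot (t + pi / 2) = - (sin t / cos t).
Proof. by rewrite /cot cosDpihalf sinDpihalf mulNr. Qed.

Lemma c1_sqrV t : c1 t ^- 2 = 2 / (cos t + sin t) ^+ 2.
Proof. by rewrite /c1 expr_div_n sqr_sqrtr // invf_div addrC. Qed.

Lemma c3_sqrV t : c3 t ^- 2 = 2 / (cos t - sin t) ^+ 2.
Proof. by rewrite /c3 expr_div_n sqr_sqrtr // invf_div -sqrrN opprB. Qed.

End Cotangents.

(** Here x1, ..., x4 are the components of the two vectors along e^(i th) v and
    i e^(i th) u, which span X1 and X3; x5 and x6 pair their D2 and D4 parts; a
    and b are, up to the same factor, the coordinates of the image of the first
    vector under J in X3 and X1. *)
Lemma kahler_identity (F : realFieldType) (c s x1 x2 x3 x4 x5 x6 : F) :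
  c != 0 -> s != 0 -> c + s != 0 -> c - s != 0 ->
  let a := - ((c - s) / (c + s)) * (x1 - x2) in
  let b := (c + s) / (c - s) * (x1 + x2) in
  2 / (c + s) ^+ 2 * (2^-1 * ((2^-1 * (a + b) - 2^-1 * (a - b)) * (x3 - x4)))
  + c ^- 2 * (- (c / s) * x6)
  + 2 / (c - s) ^+ 2 * (2^-1 * ((2^-1 * (a + b) + 2^-1 * (a - b)) * (x3 + x4)))
  + s ^- 2 * (- - (s / c) * x5)
  = 2 / (s ^+ 2 - c ^+ 2) * (x1 * x4 - x2 * x3) + (s * c)^-1 * (x5 - x6).
Proof.
move=> n1 n2 n3 n4 a b.
have -> : s ^+ 2 - c ^+ 2 = - ((c + s) * (c - s)) by ring.
by rewrite /a /b; field; rewrite n1 n2 n3 n4.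
Qed.

Section KahlerForm.
Context (R : realType) (l : nat) (t th : R) (u v : 'rV[R]_l).
Hypotheses (t4 : 0 < t < pi / 4) (uv : V2 u v).
Implicit Types a b : 'rV[R]_l.

Lemma cdot_rot_X1 a1 a2 :
  cdot (rot th (a1, a2)) (X1 th u v) = (Num.sqrt 2)^-1 * (rdot a1 v - rdot a2 u).
Proof. by rewrite /X1 cdotZr cdot_rot /cdot /= rdotNr. Qed.

Lemma cdot_rot_X3 a1 a2 :
  cdot (rot th (a1, a2)) (X3 th u v) = (Num.sqrt 2)^-1 * (rdot a1 v + rdot a2 u).
Proof. by rewrite /X3 cdotZr cdot_rot /cdot. Qed.

Lemma P2_rot a1 a2 : P2 th u v (rot th (a1, a2)) = rot th (perp_part u v a1, 0).
Proof. by rewrite /P2 rotK. Qed.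

Lemma P4_rot a1 a2 : P4 th u v (rot th (a1, a2)) = rot th (0, perp_part u v a2).
Proof. by rewrite /P4 rotK D4E. Qed.

Lemma J_at_rot a1 a2 :
  let k := (Num.sqrt 2)^-1 : R in
  let A := - cot (t + pi / 4) * (k * (rdot a1 v - rdot a2 u)) in
  let B := - cot (t + 3 * pi / 4) * (k * (rdot a1 v + rdot a2 u)) in
  J_at t th u v (rot th (a1, a2)) =
  rot th ((k * (A + B)) *: v - cot t *: perp_part u v a2,
          (k * (A - B)) *: u - cot (t + pi / 2) *: perp_part u v a1).
Proof.
move=> k A B; rewrite /J_at cdot_rot_X1 cdot_rot_X3 P2_rot P4_rot /X1 /X3 -/k -/A -/B.
rewrite !rotE /mulI /=; congr pair; apply/rowP => i; rewrite !mxE; ring.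
Qed.

Lemma ds2_at_rot a1 a2 b1 b2 :
  ds2_at t th u v (rot th (a1, a2)) (rot th (b1, b2)) =
  c1 t ^- 2 * (2^-1 * ((rdot a1 v - rdot a2 u) * (rdot b1 v - rdot b2 u)))
  + c2 t ^- 2 * rdot (perp_part u v a1) (perp_part u v b1)
  + c3 t ^- 2 * (2^-1 * ((rdot a1 v + rdot a2 u) * (rdot b1 v + rdot b2 u)))
  + c4 t ^- 2 * rdot (perp_part u v a2) (perp_part u v b2).
Proof.
have e1 p q : cdot (p *: X1 th u v) (q *: X1 th u v) = p * q.
  by rewrite cdotZl cdotZr cdot_X1X1 // mulr1.
have e3 p q : cdot (p *: X3 th u v) (q *: X3 th u v) = p * q.
  by rewrite cdotZl cdotZr cdot_X3X3 // mulr1.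
rewrite /ds2_at /P1 /P3 e1 e3 !cdot_rot_X1 !cdot_rot_X3.
rewrite !P2_rot !P4_rot !cdot_rot /cdot /= !rdot0l addr0 add0r.
have h : 2^-1 = (Num.sqrt 2)^-1 * (Num.sqrt 2)^-1 :> R.
  by rewrite -invfM -expr2 sqr_sqrtr.
by rewrite h; ring.
Qed.

(** In the plane of X1 and X3 the form is 1 / (c1 c3) times the area form, and on
    D2 + D4 it is 1 / (c2 c4) times the standard symplectic form. *)
Lemma kahler_rot a1 a2 b1 b2 :
  ds2 t (Mpt t th u v) (J t (Mpt t th u v) (rot th (a1, a2))) (rot th (b1, b2)) =
  2 / (sin t ^+ 2 - cos t ^+ 2) * (rdot a1 v * rdot b2 u - rdot a2 u * rdot b1 v)
  + (sin t * cos t)^-1 *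
    (rdot (perp_part u v a1) b2 - rdot (perp_part u v a2) b1).
Proof.
have [uu vv uv0] := uv; have vu0 : rdot v u = 0 by rewrite rdotC.
have [s0 k0 sk] := c_gt_s t4.
rewrite J_Mpt // ds2_Mpt // J_at_rot ds2_at_rot.
set A := - cot (t + pi / 4) * _; set B := - cot (t + 3 * pi / 4) * _.
have perp_u c : rdot (perp_part u v c) u = 0.
  by rewrite /perp_part !rdotE uu vu0; ring.
have perp_v c : rdot (perp_part u v c) v = 0.
  by rewrite /perp_part !rdotE vv uv0; ring.
have perp_pv x y c : perp_part u v (x *: v - y *: perp_part u v c) = - y *: perp_part u v c.
  move: (perp_u c) (perp_v c); move: (perp_part u v c) => p pu pv.
  rewrite /perp_part !rdotE pu pv vu0 vv; apply/rowP => i; rewrite !mxE; ring.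
have perp_pu x y c : perp_part u v (x *: u - y *: perp_part u v c) = - y *: perp_part u v c.
  move: (perp_u c) (perp_v c); move: (perp_part u v c) => p pu pv.
  rewrite /perp_part !rdotE pu pv uv0 uu; apply/rowP => i; rewrite !mxE; ring.
rewrite perp_pv perp_pu !rdotZl.
have perp_perp c d : rdot (perp_part u v c) (perp_part u v d) = rdot (perp_part u v c) d.
  by rewrite rdot_perp.
rewrite !perp_perp.
move: (perp_u a1) (perp_v a1) (perp_u a2) (perp_v a2) => p1u p1v p2u p2v.
move: (perp_part u v a1) (perp_part u v a2) p1u p1v p2u p2v => p1 p2 p1u p1v p2u p2v.
rewrite !rdotE ?p1u ?p1v ?p2u ?p2v ?uu ?vv ?uv0 ?vu0.
have kk : (Num.sqrt 2)^-1 * (Num.sqrt 2)^-1 = 2^-1 :> R.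
  by rewrite -invfM -expr2 sqr_sqrtr.
have -> : (Num.sqrt 2)^-1 * (A + B) = 2^-1 *
    (- ((cos t - sin t) / (cos t + sin t)) * (rdot a1 v - rdot a2 u)
    + (cos t + sin t) / (cos t - sin t) * (rdot a1 v + rdot a2 u)).
  by rewrite -kk /A /B cot_quarter cot_three_quarter; ring.
have -> : (Num.sqrt 2)^-1 * (A - B) = 2^-1 *
    (- ((cos t - sin t) / (cos t + sin t)) * (rdot a1 v - rdot a2 u)
    - (cos t + sin t) / (cos t - sin t) * (rdot a1 v + rdot a2 u)).
  by rewrite -kk /A /B cot_quarter cot_three_quarter; ring.
rewrite cot_half c1_sqrV c3_sqrV /c2 /c4 /cot; clear A B.
move: (rdot a1 v) (rdot a2 u) (rdot b1 v) (rdot b2 u) (rdot p1 b2) (rdot p2 b1)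
  => x1 x2 x3 x4 x5 x6.
have n1 : cos t != 0 by rewrite lt0r_neq0.
have n2 : sin t != 0 by rewrite lt0r_neq0.
have n3 : cos t + sin t != 0 by rewrite lt0r_neq0 // addr_gt0.
have n4 : cos t - sin t != 0 by rewrite lt0r_neq0 // subr_gt0.
clear -n1 n2 n3 n4.
move: (cos t) (sin t) n1 n2 n3 n4 => c s n1 n2 n3 n4.
rewrite !mulr0 !mulr1 !subr0.
exact: kahler_identity.
Qed.

End KahlerForm.

(** * The Kaehler form in terms of the velocities of th, u and v *)

Section Velocity.
Context (R : realType) (l : nat) (t th : R) (u v : 'rV[R]_l).
Hypotheses (t4 : 0 < t < pi / 4) (uv : V2 u v).

(** The derivative of e^(i th) (cos t u + i sin t v) when th, u, v have
    derivatives a, du, dv. *)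
Definition velocity (a : R) (du dv : 'rV[R]_l) : Cvec R l :=
  rot th (cos t *: du - (sin t * a) *: v, sin t *: dv + (cos t * a) *: u).

(** This is omega = 2 dth /\ phi - d phi, where phi = <du, v>. The hypotheses
    say that the frame (u, v) remains orthonormal to first order. The constants
    c_i have disappeared: the components of a velocity along e^(i th) v and
    i e^(i th) u, as functions of (phi, a), have determinant cos^2 t - sin^2 t,
    and those in D2 and D4 are cos t and sin t times those of du and dv. *)
Lemma kahler_velocity a du dv b eu ev :
  rdot du u = 0 -> rdot dv v = 0 -> rdot dv u = - rdot du v ->
  rdot eu u = 0 -> rdot ev v = 0 -> rdot ev u = - rdot eu v ->
  ds2 t (Mpt t th u v) (J t (Mpt t th u v) (velocity a du dv)) (velocity b eu ev) =
  2 * (a * rdot eu v - rdot du v * b) + (rdot du ev - rdot eu dv).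
Proof.
move=> duu dvv dvu euu evv evu.
have [uu vv uv0] := uv; have [s0 k0 sk] := c_gt_s t4.
rewrite kahler_rot // /perp_part !rdotE !(rdotC u) !(rdotC v).
rewrite ?(duu, dvv, dvu, euu, evv, evu, uu, vv, uv0) (rdotC dv eu).
have n1 : cos t != 0 by rewrite lt0r_neq0.
have n2 : sin t != 0 by rewrite lt0r_neq0.
have n3 : cos t + sin t != 0 by rewrite lt0r_neq0 // addr_gt0.
have n4 : cos t - sin t != 0 by rewrite lt0r_neq0 // subr_gt0.
have -> : sin t ^+ 2 - cos t ^+ 2 = - ((cos t + sin t) * (cos t - sin t)) by ring.
by field; rewrite n1 n2 n3 n4.
Qed.

(** The parametrisation by (th, u, v) is an immersion: the components along
    e^(i th) v and i e^(i th) u determine a and <du, v>, by the determinant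
    cos^2 t - sin^2 t, which is positive. *)
Lemma velocity_eq0 a du dv : rdot du u = 0 -> rdot dv v = 0 -> rdot dv u = - rdot du v ->
  velocity a du dv = 0 -> [/\ a = 0, du = 0 & dv = 0].
Proof.
move=> duu dvv dvu /(congr1 (rot (- th))); rewrite /velocity rotK rot00 => -[E1 E2].
have [uu vv _] := uv; have [s0 k0 sk] := c_gt_s t4.
have e1 := congr1 (fun x => rdot x v) E1; have e2 := congr1 (fun x => rdot x u) E2.
rewrite /= !rdotE vv in e1; rewrite /= !rdotE uu dvu in e2.
move: e1 e2; set p := rdot du v => e1 e2.
have p0 : p = 0.
  have : p * ((cos t + sin t) * (cos t - sin t)) = 0.
    transitivity (cos t * (cos t * p - sin t * a * 1)
      + sin t * (sin t * - p + cos t * a * 1)); first by ring.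
    by rewrite e1 e2; ring.
  move/eqP; rewrite mulf_eq0 => /orP[/eqP //|].
  have n3 : cos t + sin t != 0 by rewrite lt0r_neq0 // addr_gt0.
  have n4 : cos t - sin t != 0 by rewrite lt0r_neq0 // subr_gt0.
  by rewrite mulf_eq0 (negPf n3) (negPf n4).
have a0 : a = 0.
  move/eqP: e1; rewrite p0 mulr0 sub0r mulr1 oppr_eq0 mulf_eq0 gt_eqF //=.
  by move/eqP.
split=> //; apply/eqP.
  by move/eqP: E1; rewrite a0 mulr0 scale0r subr0 scaler_eq0 gt_eqF.
by move/eqP: E2; rewrite a0 mulr0 scale0r addr0 scaler_eq0 gt_eqF.
Qed.

End Velocity.

(** * Rows and complex vectors with elementary entries *)

Section Rows.
Context (R : realType) (d : nat).
Local Notation V := 'rV[R]_d.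

Definition row_cons k (b : R) (w : 'rV[R]_k) : 'rV[R]_k.+1 :=
  \row_j oapp (fun i => w 0 i) b (unlift ord0 j).

Lemma row_cons_0 k b (w : 'rV[R]_k) : row_cons b w 0 ord0 = b.
Proof. by rewrite mxE unlift_none. Qed.

Lemma row_cons_lift k b (w : 'rV[R]_k) j : row_cons b w 0 (lift ord0 j) = w 0 j.
Proof. by rewrite mxE liftK. Qed.

Lemma rowP_head k (w z : 'rV[R]_k.+1) : w 0 ord0 = z 0 ord0 ->
  (forall j, w 0 (lift ord0 j) = z 0 (lift ord0 j)) -> w = z.
Proof. by move=> h0 h; apply/rowP => j; case: (unliftP ord0 j) => [i|] ->. Qed.

Lemma rdot_row_cons k a b (w z : 'rV[R]_k) :
  rdot (row_cons a w) (row_cons b z) = a * b + rdot w z.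
Proof.
rewrite /rdot big_ord_recl !row_cons_0; congr (_ + _).
by apply: eq_bigr => i _; rewrite !row_cons_lift.
Qed.

Lemma rdot_ge0 k (w : 'rV[R]_k) : 0 <= rdot w w.
Proof. by apply: sumr_ge0 => i _; rewrite -expr2 sqr_ge0. Qed.

Definition elem_row k (w : V -> 'rV[R]_k) := forall j, elementary (fun q => w q 0 j).

Definition Drow k (h : V) (w : V -> 'rV[R]_k) (q : V) : 'rV[R]_k :=
  \row_j 'D_h (fun p => w p 0 j) q.

Lemma elem_row_cons k b (w : V -> 'rV[R]_k) : elementary b -> elem_row w ->
  elem_row (fun q => row_cons (b q) (w q)).
Proof.
move=> eb ew j; case: (unliftP ord0 j) => [i|] ->.
  by under eq_fun do rewrite row_cons_lift; exact: ew.
by under eq_fun do rewrite row_cons_0; exact: eb.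
Qed.

Lemma Drow_cons k b (w : V -> 'rV[R]_k) h q :
  Drow h (fun q => row_cons (b q) (w q)) q = row_cons ('D_h b q) (Drow h w q).
Proof.
apply: rowP_head => [|j]; rewrite [LHS]mxE ?row_cons_0 ?row_cons_lift ?mxE.
  by under eq_fun do rewrite row_cons_0.
by under eq_fun do rewrite row_cons_lift.
Qed.

Section Ops.
Context (k : nat) (a : V -> R) (w z : V -> 'rV[R]_k).
Hypotheses (ea : elementary a) (ew : elem_row w) (ez : elem_row z).

Lemma elem_row_derive h : elem_row (Drow h w).
Proof. by move=> j; under eq_fun do rewrite mxE; apply: elem_derive. Qed.

Lemma elem_row_add : elem_row (fun q => w q + z q).
Proof. by move=> j; under eq_fun do rewrite mxE; apply: elem_add. Qed.

Lemma elem_row_sub : elem_row (fun q => w q - z q).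
Proof. by move=> j; under eq_fun do rewrite !mxE; apply: elem_sub. Qed.

Lemma elem_row_scale : elem_row (fun q => a q *: w q).
Proof. by move=> j; under eq_fun do rewrite mxE; apply: elem_mul. Qed.

Lemma elem_rdot : elementary (fun q => rdot (w q) (z q)).
Proof. by apply: elem_sum => i; apply: elem_mul. Qed.

Lemma Drow_add h q : Drow h (fun q => w q + z q) q = Drow h w q + Drow h z q.
Proof.
apply/rowP => j; rewrite !mxE; under eq_fun do rewrite mxE.
exact: D_add.
Qed.

Lemma Drow_sub h q : Drow h (fun q => w q - z q) q = Drow h w q - Drow h z q.
Proof.
apply/rowP => j; rewrite !mxE; under eq_fun do rewrite !mxE.
exact: D_sub.
Qed.

Lemma Drow_scale h q :
  Drow h (fun q => a q *: w q) q = 'D_h a q *: w q + a q *: Drow h w q.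
Proof.
apply/rowP => j; rewrite !mxE; under eq_fun do rewrite mxE.
by rewrite D_mul // addrC [w q 0 j * _]mulrC.
Qed.

Lemma D_rdot h q : 'D_h (fun q => rdot (w q) (z q)) q =
  rdot (Drow h w q) (z q) + rdot (w q) (Drow h z q).
Proof.
rewrite /rdot D_sum => [|i]; last exact: elem_mul.
rewrite -big_split; apply: eq_bigr => i _.
by rewrite D_mul // !mxE addrC; congr (_ + _); rewrite mulrC.
Qed.

End Ops.

Lemma elem_row_linear k (s : 'I_k -> 'I_d) : elem_row (fun q => \row_j q 0 (s j)).
Proof. by move=> j; under eq_fun do rewrite mxE; exact: elem_coord. Qed.

Lemma Drow_linear k (s : 'I_k -> 'I_d) h q :
  Drow h (fun q => \row_j q 0 (s j)) q = \row_j h 0 (s j).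
Proof. by apply/rowP => j; rewrite !mxE; under eq_fun do rewrite mxE; rewrite D_coord. Qed.

Section Cvec.
Context (l : nat) (a b : V -> 'rV[R]_l).
Hypotheses (ea : elem_row a) (eb : elem_row b).

Let base (i : 'I_(l + l)) : Cvec R l :=
  match fintype.split i with inl j => (delta_mx 0 j, 0) | inr j => (0, delta_mx 0 j) end.

Let coef (i : 'I_(l + l)) : V -> R :=
  match fintype.split i with inl j => fun q => a q 0 j | inr j => fun q => b q 0 j end.

Let ecoef i : elementary (coef i).
Proof. by rewrite /coef; case: fintype.split. Qed.

Let sum_base (F : 'I_(l + l) -> R) : \sum_i F i *: base i =
  (\row_j F (lshift l j), \row_j F (rshift l j)).
Proof.
have sl j : fintype.split (lshift l j) = inl j by rewrite -(unsplitK (inl j)).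
have sr j : fintype.split (rshift l j) = inr j by rewrite -(unsplitK (inr j)).
rewrite big_split_ord /= /base.
under eq_bigr do rewrite sl; under [X in _ + X]eq_bigr do rewrite sr.
have fst_sum (I : finType) (G : I -> Cvec R l) : (\sum_i G i).1 = \sum_i (G i).1.
  by apply: (big_morph fst).
have snd_sum (I : finType) (G : I -> Cvec R l) : (\sum_i G i).2 = \sum_i (G i).2.
  by apply: (big_morph snd).
rewrite [LHS]surjective_pairing /=.
rewrite !fst_sum !snd_sum /=; congr pair.
  rewrite [X in _ + X]big1 ?addr0 => [|i _]; last by rewrite scaler0.
  by rewrite [RHS]row_sum_delta; apply: eq_bigr => j _; rewrite mxE.
rewrite [X in X + _]big1 ?add0r => [|i _]; last by rewrite scaler0.
by rewrite [RHS]row_sum_delta; apply: eq_bigr => j _; rewrite mxE.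
Qed.

Let abE : (fun q => (a q, b q) : Cvec R l) = fun q => \sum_i coef i q *: base i.
Proof.
apply: funext => q; rewrite sum_base; congr pair; apply/rowP => j; rewrite mxE /coef.
  by rewrite (unsplitK (inl j)).
by rewrite (unsplitK (inr j)).
Qed.

Lemma Cvec_smooth : smooth_on setT (fun q => (a q, b q) : Cvec R l).
Proof. rewrite abE; exact: elem_vec_smooth. Qed.

Lemma Cvec_differentiable q : differentiable (fun q => (a q, b q) : Cvec R l) q.
Proof. rewrite abE; exact: elem_vec_differentiable. Qed.

Lemma D_Cvec h q : 'D_h (fun q => (a q, b q) : Cvec R l) q = (Drow h a q, Drow h b q).
Proof.
rewrite abE D_vec // sum_base; congr pair; apply/rowP => j; rewrite !mxE /coef.
  by rewrite (unsplitK (inl j)).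
by rewrite (unsplitK (inr j)).
Qed.

End Cvec.
End Rows.

(** * Stereographic parametrisation of orthonormal pairs *)

Section Stereographic.
Context (R : realType).

(** The conformal factor of the inverse stereographic projection w |-> stereo w
    of R^k into the unit sphere of R^(k+1). *)
Definition conf k (w : 'rV[R]_k) : R := 2 / (1 + rdot w w).

Definition stereo k (w : 'rV[R]_k) : 'rV[R]_k.+1 := row_cons (conf w - 1) (conf w *: w).

(** The differential of stereo at x, applied to y and divided by conf x; the
    division makes y |-> tang x y an isometry onto the orthogonal complement of
    stereo x. *)
Definition tang k (x : 'rV[R]_k) (y : 'rV[R]_k) : 'rV[R]_k.+1 :=
  row_cons (- (conf x * rdot x y)) (y - (conf x * rdot x y) *: x).

Lemma conf_den k (w : 'rV[R]_k) : 1 + rdot w w != 0.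
Proof. by rewrite lt0r_neq0 // ltr_pwDl // rdot_ge0. Qed.

Lemma confE k (w : 'rV[R]_k) : conf w * rdot w w = 2 - conf w.
Proof.
apply/eqP; rewrite eq_sym subr_eq -{2}[conf w]mulr1 -mulrDr addrC.
by rewrite /conf mulfVK // conf_den.
Qed.

Lemma conf_neq0 k (w : 'rV[R]_k) : conf w != 0.
Proof. by rewrite mulf_neq0 ?invr_eq0 ?conf_den // pnatr_eq0. Qed.

Lemma rdot_stereo k (w : 'rV[R]_k) : rdot (stereo w) (stereo w) = 1.
Proof.
rewrite rdot_row_cons !rdotE.
transitivity ((conf w - 1) ^+ 2 + conf w * (conf w * rdot w w)); first by ring.
by rewrite confE; ring.
Qed.

Lemma rdot_stereo_tang k (x y : 'rV[R]_k) : rdot (stereo x) (tang x y) = 0.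
Proof.
rewrite rdot_row_cons !rdotE; set r := rdot x y.
transitivity (r * conf x * (2 - conf x - conf x * rdot x x)); first by ring.
by rewrite confE; ring.
Qed.

Lemma rdot_tang k (x y : 'rV[R]_k) : rdot (tang x y) (tang x y) = rdot y y.
Proof.
rewrite rdot_row_cons !rdotE (rdotC y x); set r := rdot x y.
transitivity (rdot y y + r ^+ 2 * conf x * (conf x + conf x * rdot x x - 2)); first by ring.
by rewrite confE; ring.
Qed.

Context (d k : nat) (w : 'rV[R]_d -> 'rV[R]_k).
Hypothesis ew : elem_row w.

Lemma elem_conf : elementary (fun q => conf (w q)).
Proof.
apply: elem_mul; first exact: elem_cst.
apply: elem_inv; last by move=> q; exact: conf_den.
by apply: elem_add; [exact: elem_cst | exact: elem_rdot].
Qed.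

Lemma D_conf h q :
  'D_h (fun q => conf (w q)) q = - conf (w q) ^+ 2 * rdot (w q) (Drow h w q).
Proof.
have e1 : elementary (fun q => 1 + rdot (w q) (w q)).
  by apply: elem_add; [exact: elem_cst | exact: elem_rdot].
have e2 : elementary (fun q => (1 + rdot (w q) (w q))^-1).
  by apply: elem_inv e1 _ => p; exact: conf_den.
rewrite D_mul //; last exact: elem_cst.
rewrite D_cst mulr0 addr0 D_inv ?conf_den // D_add //; last by exact: elem_rdot.
  rewrite D_cst add0r D_rdot // (rdotC (Drow _ _ _)) /conf.
  by have := conf_den (w q) => h0; field.
exact: elem_cst.
Qed.

Lemma elem_row_stereo : elem_row (fun q => stereo (w q)).
Proof.
apply: elem_row_cons.
  by apply: elem_sub; [exact: elem_conf | exact: elem_cst].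
by apply: elem_row_scale => //; exact: elem_conf.
Qed.

Lemma Drow_stereo h q : let dr := 'D_h (fun q => conf (w q)) q in
  Drow h (fun q => stereo (w q)) q =
  row_cons dr (dr *: w q + conf (w q) *: Drow h w q).
Proof.
move=> dr; rewrite Drow_cons Drow_scale //; last exact: elem_conf.
rewrite D_sub ?D_cst ?subr0 //; first exact: elem_conf.
exact: elem_cst.
Qed.

Lemma Drow_stereo_eq0 h q : Drow h (fun q => stereo (w q)) q = 0 -> Drow h w q = 0.
Proof.
rewrite Drow_stereo; set dr := 'D_h _ q => E.
have dr0 : dr = 0 by have := congr1 (fun r : 'rV_k.+1 => r 0 ord0) E; rewrite row_cons_0 mxE.
apply/rowP => j; have := congr1 (fun r : 'rV_k.+1 => r 0 (lift ord0 j)) E.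
rewrite row_cons_lift dr0 scale0r add0r mxE [RHS]mxE => /eqP.
by rewrite mulf_eq0 (negPf (conf_neq0 _)) => /eqP ->; rewrite mxE.
Qed.

(** The stereographic parametrisation is conformal and tang is its normalised
    differential, so this scalar product is the one before projection, times the
    conformal factor. *)
Lemma rdot_Dstereo_tang h q y :
  rdot (Drow h (fun q => stereo (w q)) q) (tang (w q) y) = conf (w q) * rdot (Drow h w q) y.
Proof.
rewrite Drow_stereo D_conf rdot_row_cons !rdotE (rdotC (Drow h w q) (w q)).
set r := rdot (w q) y; set s := rdot (w q) _; set c := conf (w q).
have hc : c * rdot (w q) (w q) = 2 - c by exact: confE.
move: (rdot (w q) (w q)) (rdot (Drow h w q) y) hc => W b hc.
clearbody c r s.
transitivity (c * b + c ^+ 2 * s * r * (c + c * W - 2)); first by ring.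
by rewrite hc; ring.
Qed.

Context (y : 'rV[R]_d -> 'rV[R]_k) (ey : elem_row y).

Let kap q := conf (w q) * rdot (w q) (y q).

Let ekap : elementary kap.
Proof. by apply: elem_mul; [exact: elem_conf | exact: elem_rdot]. Qed.

Lemma elem_row_tang : elem_row (fun q => tang (w q) (y q)).
Proof.
apply: elem_row_cons; first exact: elem_opp ekap.
by apply: elem_row_sub => //; exact: elem_row_scale ekap _.
Qed.

Lemma Drow_tang h q : let dk := 'D_h kap q in
  Drow h (fun q => tang (w q) (y q)) q =
  row_cons (- dk) (Drow h y q - (dk *: w q + kap q *: Drow h w q)).
Proof.
move=> dk; rewrite Drow_cons Drow_sub //; last exact: elem_row_scale ekap _.
by rewrite D_opp // Drow_scale.
Qed.

Lemma Drow_tang_eq0 h q : Drow h w q = 0 ->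
  Drow h (fun q => tang (w q) (y q)) q = 0 -> Drow h y q = 0.
Proof.
move=> dw; rewrite Drow_tang dw; set dk := 'D_h _ q => E.
have dk0 : dk = 0.
  have := congr1 (fun r : 'rV_k.+1 => r 0 ord0) E; rewrite row_cons_0 mxE => /eqP.
  by rewrite oppr_eq0 => /eqP.
apply/rowP => j; have := congr1 (fun r : 'rV_k.+1 => r 0 (lift ord0 j)) E.
by rewrite row_cons_lift dk0 scale0r scaler0 addr0 subr0 [X in _ = X -> _]mxE => ->; rewrite mxE.
Qed.

End Stereographic.

(** * A parametrisation of M_t *)

Section Parametrisation.
Context (R : realType) (n : nat) (t : R).
Hypothesis t4 : 0 < t < pi / 4.
Local Notation V := 'rV[R]_(n.+1.*2).

(** The coordinates of q are ordered as x_0, th, x_1, z_1, ..., x_n, z_n, so that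
    dropping the first one leaves th followed by the Darboux pairs. *)
Definition theta (q : V) : R := q 0 (pair_pos ord0 ord_max).
Definition xpart (q : V) : 'rV[R]_n.+1 := \row_k q 0 (pair_pos k ord0).
Definition zpart (q : V) : 'rV[R]_n := \row_a q 0 (pair_pos (lift ord0 a) ord_max).

Definition uvec (q : V) : 'rV[R]_n.+2 := stereo (xpart q).
Definition yvec (q : V) : 'rV[R]_n.+1 := stereo (zpart q).
Definition vvec (q : V) : 'rV[R]_n.+2 := tang (xpart q) (yvec q).
Definition param (q : V) : Cvec R n.+2 := Mpt t (theta q) (uvec q) (vvec q).

Lemma coord_eq0 (q : V) : theta q = 0 -> xpart q = 0 -> zpart q = 0 -> q = 0.
Proof.
move=> h0 hx hz; apply/rowP => i; rewrite [RHS]mxE.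
have hk : (i./2 < n.+1)%N by have := ltn_ord i; lia.
have [oi|ei] := boolP (odd i).
  have [k0|k0] := eqVneq i./2 0%N.
    rewrite -[RHS]h0 /theta; congr (q 0 _); apply: val_inj => /=; lia.
  have hj : (i./2.-1 < n)%N by lia.
  have /= := congr1 (fun r : 'rV_n => r 0 (Ordinal hj)) hz; rewrite !mxE => <-.
  congr (q 0 _); apply: val_inj => /=; rewrite /bump /=; lia.
have := congr1 (fun r : 'rV_n.+1 => r 0 (Ordinal hk)) hx; rewrite !mxE => <-.
congr (q 0 _); apply: val_inj => /=; lia.
Qed.

Lemma elem_theta : elementary theta. Proof. exact: elem_coord. Qed.
Lemma elem_xpart : elem_row xpart. Proof. exact: elem_row_linear. Qed.
Lemma elem_zpart : elem_row zpart. Proof. exact: elem_row_linear. Qed.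
Lemma elem_uvec : elem_row uvec. Proof. exact: elem_row_stereo elem_xpart. Qed.
Lemma elem_yvec : elem_row yvec. Proof. exact: elem_row_stereo elem_zpart. Qed.
Lemma elem_vvec : elem_row vvec. Proof. have h := elem_row_tang elem_xpart elem_yvec; exact: h. Qed.

Lemma uvec_vvec q : V2 (uvec q) (vvec q).
Proof.
split; first exact: rdot_stereo.
  by rewrite rdot_tang rdot_stereo.
exact: rdot_stereo_tang.
Qed.

Lemma rdot_Duvec_uvec h q : rdot (Drow h uvec q) (uvec q) = 0.
Proof.
have := D_rdot elem_uvec elem_uvec h q.
under eq_fun do rewrite rdot_stereo.
by rewrite D_cst (rdotC (uvec q)) => /esym/eqP; rewrite -mulr2n mulrn_eq0 /= => /eqP.
Qed.

Lemma rdot_Dvvec_vvec h q : rdot (Drow h vvec q) (vvec q) = 0.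
Proof.
have := D_rdot elem_vvec elem_vvec h q.
under eq_fun do rewrite rdot_tang rdot_stereo.
by rewrite D_cst (rdotC (vvec q)) => /esym/eqP; rewrite -mulr2n mulrn_eq0 /= => /eqP.
Qed.

Lemma rdot_Dvvec_uvec h q : rdot (Drow h vvec q) (uvec q) = - rdot (Drow h uvec q) (vvec q).
Proof.
have := D_rdot elem_uvec elem_vvec h q.
under eq_fun do rewrite rdot_stereo_tang.
by rewrite D_cst (rdotC (uvec q)) => /esym/eqP; rewrite addrC addr_eq0 => /eqP.
Qed.

Lemma paramE : param = fun q =>
  (cos (theta q) *: (cos t *: uvec q) - sin (theta q) *: (sin t *: vvec q),
   cos (theta q) *: (sin t *: vvec q) + sin (theta q) *: (cos t *: uvec q)).
Proof. by apply: funext => q; rewrite /param /Mpt rotE. Qed.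

Let ec : elementary (fun q => cos (theta q)). Proof. exact: elem_cos elem_theta. Qed.
Let es : elementary (fun q => sin (theta q)). Proof. exact: elem_sin elem_theta. Qed.
Let eu : elem_row (fun q => cos t *: uvec q).
Proof. by apply: elem_row_scale; [exact: elem_cst | exact: elem_uvec]. Qed.
Let ev : elem_row (fun q => sin t *: vvec q).
Proof. by apply: elem_row_scale; [exact: elem_cst | exact: elem_vvec]. Qed.
Let e1 : elem_row (fun q =>
  cos (theta q) *: (cos t *: uvec q) - sin (theta q) *: (sin t *: vvec q)).
Proof. by apply: elem_row_sub; exact: elem_row_scale. Qed.
Let e2 : elem_row (fun q =>
  cos (theta q) *: (sin t *: vvec q) + sin (theta q) *: (cos t *: uvec q)).
Proof. by apply: elem_row_add; exact: elem_row_scale. Qed.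

Lemma D_param h q : 'D_h param q =
  velocity t (theta q) (uvec q) (vvec q) (theta h) (Drow h uvec q) (Drow h vvec q).
Proof.
rewrite paramE D_Cvec // Drow_sub ?Drow_add; try exact: elem_row_scale.
rewrite !(Drow_scale ec) // !(Drow_scale es) //.
have hu : Drow h (fun q => cos t *: uvec q) q = cos t *: Drow h uvec q.
  by rewrite (Drow_scale (elem_cst _ (cos t)) elem_uvec) D_cst scale0r add0r.
have hv : Drow h (fun q => sin t *: vvec q) q = sin t *: Drow h vvec q.
  by rewrite (Drow_scale (elem_cst _ (sin t)) elem_vvec) D_cst scale0r add0r.
rewrite hu hv (D_cos _ _ elem_theta) (D_sin _ _ elem_theta) D_coord -/(theta h).
by rewrite /velocity rotE /=; congr pair; apply/rowP => j; rewrite !mxE; ring.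
Qed.

Lemma param_local : local_param (Mt t) setT param.
Proof.
split.
- exact: openT.
- by rewrite paramE; exact: Cvec_smooth.
- move=> q _; have dp : differentiable param q.
    by rewrite paramE; exact: Cvec_differentiable.
  suff ker h : 'd param q h = 0 -> h = 0.
    move=> h h' E; apply/eqP; rewrite -subr_eq0; apply/eqP/ker.
    by rewrite linearB E subrr.
  rewrite -deriveE // D_param => E.
  have [th0 du0 dv0] := velocity_eq0 t4 (uvec_vvec q)
    (rdot_Duvec_uvec h q) (rdot_Dvvec_vvec h q) (rdot_Dvvec_uvec h q) E.
  have dx0 := Drow_stereo_eq0 elem_xpart du0.
  have dy0 := Drow_tang_eq0 elem_xpart elem_yvec dx0 dv0.
  have dz0 := Drow_stereo_eq0 elem_zpart dy0.
  apply: coord_eq0 => //; [rewrite -dx0 | rewrite -dz0]; exact: (esym (Drow_linear _ _ _)).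
- by move=> q _; exists (theta q), (uvec q), (vvec q); split=> //; exact: uvec_vvec.
Qed.

(** The pulled-back Kaehler form, on constant vector fields. *)
Definition omega (h h' : V) (q : V) : R :=
  ds2 t (param q) (J t (param q) ('D_h param q)) ('D_h' param q).

Lemma omegaE h h' q : omega h h' q =
  2 * (theta h * (conf (xpart q) * rdot (xpart h') (yvec q))
       - conf (xpart q) * rdot (xpart h) (yvec q) * theta h')
  + (rdot (Drow h uvec q) (Drow h' vvec q) - rdot (Drow h' uvec q) (Drow h vvec q)).
Proof.
rewrite /omega !D_param (kahler_velocity _ t4 (uvec_vvec q) _ _
  (rdot_Duvec_uvec h q) (rdot_Dvvec_vvec h q) (rdot_Dvvec_uvec h q)
  (rdot_Duvec_uvec h' q) (rdot_Dvvec_vvec h' q) (rdot_Dvvec_uvec h' q)).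
have du g : rdot (Drow g uvec q) (vvec q) = conf (xpart q) * rdot (xpart g) (yvec q).
  have := rdot_Dstereo_tang elem_xpart g q (yvec q).
  by rewrite [Drow g xpart q]Drow_linear.
by rewrite !du.
Qed.

Lemma elem_omega h h' : elementary (omega h h').
Proof.
have er g : elementary (fun q => conf (xpart q) * rdot (xpart g) (yvec q)).
  apply: (elem_mul (elem_conf elem_xpart)).
  by apply: (@elem_rdot _ _ _ (fun=> xpart g) yvec) => [j|]; [exact: elem_cst|exact: elem_yvec].
have ed g g' : elementary (fun q => rdot (Drow g uvec q) (Drow g' vvec q)).
  by apply: elem_rdot; apply: elem_row_derive; [exact: elem_uvec|exact: elem_vvec].
rewrite (funext (omegaE h h')).
apply: elem_add; last exact: (elem_sub (ed _ _) (ed _ _)).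
apply: elem_mul; first exact: elem_cst.
apply: elem_sub.
  exact: (elem_mul (elem_cst _ _) (er h')).
exact: (elem_mul (er h) (elem_cst _ _)).
Qed.

End Parametrisation.

(** * The Kaehler form to first order at the origin *)

(** The exterior derivative is evaluated on all the coordinate fields except the
    one along x_0, labelled by 0 for th, and by ix a and iz a for x_(a+1) and
    z_(a+1). At the origin phi vanishes on all of them. *)
Section Labels.
Context {n : nat}.
Local Notation label := 'I_(n.*2).+1.

Definition ix (a : 'I_n) : label := lift ord0 (pair_pos a ord0).
Definition iz (a : 'I_n) : label := lift ord0 (pair_pos a ord_max).

Lemma ix_inj : injective ix.
Proof.
move=> a b /lift_inj/(congr1 val) /= E; apply: val_inj => /=; move: E; lia.
Qed.

Lemma iz_inj : injective iz.
Proof.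
move=> a b /lift_inj/(congr1 val) /= E; apply: val_inj => /=; move: E; lia.
Qed.

Lemma ix_neq_iz a b : ix a != iz b.
Proof. by apply/eqP => /lift_inj/(congr1 val) /=; lia. Qed.

Lemma label_cover i : i = ord0 \/ exists a, i = ix a \/ i = iz a.
Proof.
case: (unliftP ord0 i) => [j|] ->; last by left.
right; have hj : (j./2 < n)%N by have := ltn_ord j; lia.
exists (Ordinal hj); have [oj|ej] := boolP (odd j); [right|left];
  congr (lift _ _); apply: val_inj => /=; lia.
Qed.

Lemma lift_ix a : lift ord0 (ix a) = pair_pos (lift ord0 a) ord0 :> 'I_(n.+1.*2).
Proof. by apply: val_inj => /=; rewrite /bump /=; lia. Qed.

Lemma lift_iz a : lift ord0 (iz a) = pair_pos (lift ord0 a) ord_max :> 'I_(n.+1.*2).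
Proof. by apply: val_inj => /=; rewrite /bump /=; lia. Qed.

Lemma ord0_neq_ix a : ord0 != ix a. Proof. exact: neq_lift. Qed.

Lemma ord0_neq_iz a : ord0 != iz a. Proof. exact: neq_lift. Qed.

End Labels.

Section Origin.
Context (R : realType) (n : nat) (t : R).
Hypothesis t4 : 0 < t < pi / 4.
Local Notation V := 'rV[R]_(n.+1.*2).
Local Notation label := 'I_(n.*2).+1.
Implicit Types i j k : label.

Definition dir i : V := delta_mx 0 (lift ord0 i).

Lemma theta_dir i : theta (dir i) = (i == ord0)%:R.
Proof.
rewrite /theta mxE eqxx /=; congr (_ %:R).
have -> : pair_pos ord0 ord_max = lift ord0 ord0 :> 'I_(n.+1.*2) by apply: val_inj.
by rewrite (inj_eq lift_inj) eq_sym.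
Qed.

Lemma xpart_dir i : xpart (dir i) = row_cons 0 (\row_a (i == ix a)%:R).
Proof.
apply: rowP_head => [|a]; rewrite ?row_cons_0 ?row_cons_lift !mxE eqxx //=.
by rewrite -lift_ix (inj_eq lift_inj) eq_sym.
Qed.

Lemma zpart_dir i : zpart (dir i) = \row_a (i == iz a)%:R.
Proof.
by apply/rowP => a; rewrite !mxE eqxx /= -lift_iz (inj_eq lift_inj) eq_sym.
Qed.

Lemma conf0 (m : nat) : conf (0 : 'rV[R]_m) = 2.
Proof. by rewrite /conf rdot0l addr0 divr1. Qed.

Lemma xpart0 : xpart (0 : V) = 0.
Proof. by apply/rowP => k; rewrite !mxE. Qed.

Lemma zpart0 : zpart (0 : V) = 0.
Proof. by apply/rowP => k; rewrite !mxE. Qed.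

Lemma yvec0 : yvec (0 : V) = row_cons 1 0.
Proof.
rewrite /yvec /stereo zpart0. by rewrite conf0 scaler0; congr row_cons; ring.
Qed.

Lemma Dconf0 h : 'D_h (fun q : V => conf (xpart q)) 0 = 0.
Proof. by rewrite D_conf ?xpart0 ?rdot0l ?mulr0 //; exact: elem_xpart. Qed.

Lemma Duvec0 (h : V) : Drow h (@uvec R n) 0 = row_cons 0 (2 *: xpart h).
Proof.
rewrite [LHS](Drow_stereo (@elem_xpart R n)) Dconf0 scale0r add0r xpart0 conf0.
by rewrite [Drow _ _ _]Drow_linear.
Qed.

Lemma Dyvec0 (h : V) : Drow h (@yvec R n) 0 = row_cons 0 (2 *: zpart h).
Proof.
rewrite [LHS](Drow_stereo (@elem_zpart R n)) D_conf; last exact: elem_zpart.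
rewrite zpart0 rdot0l mulr0 scale0r add0r conf0.
by rewrite [Drow _ _ _]Drow_linear.
Qed.

(** The derivative of <x, y>, on which the derivative of v depends, only enters
    the first entry of that derivative, and there the derivative of u has a
    zero. *)
Lemma rdot_DuDv0 (h h' : V) : rdot (Drow h (@uvec R n) 0) (Drow h' (@vvec R n) 0) =
  2 * rdot (xpart h) (row_cons 0 (2 *: zpart h')).
Proof.
have dv := Drow_tang (@elem_xpart R n) (@elem_yvec R n) h' 0.
rewrite /= xpart0 scaler0 add0r rdot0l mulr0 scale0r subr0 Dyvec0 in dv.
by rewrite Duvec0 [X in rdot _ X]dv rdot_row_cons mul0r add0r rdotZl.
Qed.

Lemma rdot_dir i j : rdot (xpart (dir i)) (row_cons 0 (2 *: zpart (dir j))) =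
  2 * matched R ix iz i j.
Proof.
rewrite xpart_dir zpart_dir rdot_row_cons mul0r add0r rdotZr; congr (_ * _).
by apply: eq_bigr => a _; rewrite !mxE -natrM mulnb.
Qed.

Local Notation om i j := (omega t (dir i) (dir j)).

Lemma rdot_dir_y0 i : rdot (xpart (dir i)) (yvec (0 : V)) = 0.
Proof. by rewrite xpart_dir yvec0 rdot_row_cons mul0r rdot0r addr0. Qed.

Lemma omega_origin i j : om i j 0 = 4 * pairing R ix iz i j.
Proof.
rewrite omegaE // (rdot_dir_y0 i) (rdot_dir_y0 j) !mulr0 mul0r subrr mulr0 add0r.
transitivity (2 * (2 * matched R ix iz i j) - 2 * (2 * matched R ix iz j i)).
  by congr (_ - _); rewrite rdot_DuDv0 rdot_dir.
rewrite /pairing sumrB; under [X in _ = _ * (_ - X)]eq_bigr do rewrite andbC.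
by rewrite -/(matched R ix iz i j) -/(matched R ix iz j i); ring.
Qed.

Lemma omegaC i j q : om j i q = - om i j q.
Proof.
have alg (a b c d e f : R) : 2 * (a * b - c * d) + (e - f) = - (2 * (d * c - b * a) + (f - e)).
  by ring.
by rewrite (omegaE t4 (dir j)) (omegaE t4 (dir i)); exact: alg.
Qed.

Lemma xpart_inv (q : V) a : xpart (q + a *: dir ord0) = xpart q.
Proof.
apply/rowP => k; rewrite !mxE eqxx /= [_ == _](_ : _ = false) ?mulr0 ?addr0 //.
by apply/eqP => /(congr1 val) /=; rewrite /bump; lia.
Qed.

Lemma zpart_inv (q : V) a : zpart (q + a *: dir ord0) = zpart q.
Proof.
by apply/rowP => k; rewrite !mxE eqxx /= mulr0 addr0.
Qed.

Lemma uvec_inv (q : V) a : uvec (q + a *: dir ord0) = uvec q.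
Proof. by rewrite /uvec xpart_inv. Qed.

Lemma yvec_inv (q : V) a : yvec (q + a *: dir ord0) = yvec q.
Proof. by rewrite /yvec zpart_inv. Qed.

Lemma vvec_inv (q : V) a : vvec (q + a *: dir ord0) = vvec q.
Proof. by rewrite /vvec xpart_inv yvec_inv. Qed.

Lemma Drow_inv m (w : V -> 'rV[R]_m) h : (forall q a, w (q + a *: dir ord0) = w q) ->
  forall q a, Drow h w (q + a *: dir ord0) = Drow h w q.
Proof.
move=> inv q a; apply/rowP => j; rewrite !mxE.
by apply: (@invariant_derive _ _ (dir ord0)) => p b; rewrite inv.
Qed.

Lemma Drow_dir0 m (w : V -> 'rV[R]_m) q : (forall q a, w (q + a *: dir ord0) = w q) ->
  Drow (dir ord0) w q = 0.
Proof.
move=> inv; apply/rowP => j; rewrite !mxE.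
by apply: derive_invariant => p b; rewrite inv.
Qed.

(** The form depends on the point through u, v and their derivatives only, which
    the rotation parameter does not change. *)
Lemma omega_congr (h h' p q : V) : xpart p = xpart q -> yvec p = yvec q ->
  (forall g, Drow g (@uvec R n) p = Drow g (@uvec R n) q) ->
  (forall g, Drow g (@vvec R n) p = Drow g (@vvec R n) q) ->
  omega t h h' p = omega t h h' q.
Proof.
move=> hx hy hu hv; rewrite (omegaE t4 h h' p) (omegaE t4 h h' q) hx hy.
by rewrite (hu h) (hu h') (hv h) (hv h').
Qed.

Lemma D_theta_omega i j q : 'D_(dir ord0) (om i j) q = 0.
Proof.
apply: derive_invariant => p a; apply: omega_congr.
- exact: xpart_inv.
- exact: yvec_inv.
- by move=> g; apply: Drow_inv; exact: uvec_inv.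
- by move=> g; apply: Drow_inv; exact: vvec_inv.
Qed.

(** Along th, omega is 2 phi = 2 conf x <dx, y>; to first order at the origin
    only the variation of y with z contributes. *)
Lemma D_omega_origin i j : 'D_(dir i) (om ord0 j) 0 = 8 * matched R ix iz j i.
Proof.
have ey := @elem_yvec R n.
have er : elementary (fun q : V => rdot (xpart (dir j)) (yvec q)).
  by apply: (@elem_rdot _ _ _ (fun=> xpart (dir j)) (@yvec R n)) => // k; exact: elem_cst.
have ec := elem_conf (@elem_xpart R n).
have -> : om ord0 j = fun q => 2 * (conf (xpart q) * rdot (xpart (dir j)) (yvec q)).
  apply: funext => q; rewrite omegaE // (Drow_dir0 _ uvec_inv) (Drow_dir0 _ vvec_inv).
  rewrite rdot0l rdot0r subrr addr0 theta_dir eqxx mul1r.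
  rewrite [xpart (dir ord0)](_ : _ = 0) ?rdot0l ?mulr0 ?mul0r ?subr0 //.
  apply/rowP => k; rewrite xpart_dir mxE [RHS]mxE; case: unliftP => [b|] //= _.
  by rewrite mxE.
rewrite D_mul; [|exact: elem_cst|exact: elem_mul].
rewrite D_cst mulr0 addr0 D_mul // Dconf0 mulr0 addr0 xpart0 conf0.
have -> : 'D_(dir i) (fun q : V => rdot (xpart (dir j)) (yvec q)) 0 =
    rdot (xpart (dir j)) (Drow (dir i) (@yvec R n) 0).
  have := D_rdot (w := fun=> xpart (dir j)) (z := @yvec R n) _ ey (dir i) 0.
  move=> ->; last by move=> k; exact: elem_cst.
  rewrite [Drow _ (fun=> _) _](_ : _ = 0) ?rdot0l ?add0r //.
  by apply/rowP => k; rewrite !mxE D_cst.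
by rewrite Dyvec0 rdot_dir; ring.
Qed.

End Origin.

(** * The exterior derivative at the origin *)

Section Terms.
Context (R : realType) (n : nat) (t : R).
Hypothesis t4 : 0 < t < pi / 4.
Local Notation label := 'I_(n.*2).+1.
Local Notation dir := (@dir R n).

Definition omega_at0 (i j : label) : R := omega t (dir i) (dir j) 0.
Definition domega_at0 (i j k : label) : R := 'D_(dir i) (omega t (dir j) (dir k)) 0.

Lemma domega_at0_anti i j k : domega_at0 i k j = - domega_at0 i j k.
Proof.
rewrite /domega_at0 -D_opp; last exact: elem_omega.
by congr ('D__ _ _); apply: funext => q; rewrite omegaC.
Qed.

Lemma lift_perm_ix (i : label) (s : 'S_(n.*2)) a :
  lift_perm ord0 i s (ix a) = lift i (s (pair_pos a ord0)).
Proof. exact: lift_perm_lift. Qed.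

Lemma lift_perm_iz (i : label) (s : 'S_(n.*2)) a :
  lift_perm ord0 i s (iz a) = lift i (s (pair_pos a ord_max)).
Proof. exact: lift_perm_lift. Qed.

Local Notation term := (dterm ord0 (@ix n) (@iz n) omega_at0 domega_at0).

Lemma term_ge0 s k : 0 <= term s k.
Proof.
apply: (@dterm_ge0 R _ n ord0 ix iz ix_inj iz_inj ix_neq_iz ord0_neq_ix ord0_neq_iz
  label_cover _ _ 4 8) => //.
- by move=> i j; exact: omega_origin.
- exact: domega_at0_anti.
- by move=> i j; exact: D_theta_omega.
- by move=> i j; exact: D_omega_origin.
Qed.

Lemma D_wedge_exp_omega (i : label) : 'D_(dir i) (fun q : 'rV[R]_(n.+1.*2) =>
    wedge_exp (kahler_form (J t) (ds2 t) (param t q)) n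
      (fun j => 'D_(dir (lift i j)) (param t) q)) 0 =
  (2 ^+ n)^-1 * \sum_(s : 'S_(n.*2)) (-1) ^+ s *
     \sum_k domega_at0 i (lift i (s (pair_pos k ord0))) (lift i (s (pair_pos k ord_max))) *
       \prod_(a < n | a != k)
         omega_at0 (lift i (s (pair_pos a ord0))) (lift i (s (pair_pos a ord_max))).
Proof.
pose F (s : 'S_(n.*2)) k :=
  omega t (dir (lift i (s (pair_pos k ord0)))) (dir (lift i (s (pair_pos k ord_max)))).
have eF s k : elementary (F s k) by exact: elem_omega.
have -> : (fun q : 'rV[R]_(n.+1.*2) =>
    wedge_exp (kahler_form (J t) (ds2 t) (param t q)) n
      (fun j => 'D_(dir (lift i j)) (param t) q)) =
    fun q => (2 ^+ n)^-1 * \sum_(s : 'S_(n.*2)) (-1) ^+ s * \prod_(k < n) F s k q.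
  by apply: funext => q; rewrite wedge_expE.
have eP (s : 'S_(n.*2)) : elementary (fun q => (-1) ^+ s * \prod_(k < n) F s k q).
  by apply: elem_mul; [exact: elem_cst | exact: elem_prod].
rewrite D_mul; [|exact: elem_cst|exact: elem_sum].
rewrite D_cst mulr0 addr0 D_sum //; congr (_ * _); apply: eq_bigr => s _.
rewrite D_mul; [|exact: elem_cst|exact: elem_prod].
by rewrite D_cst mulr0 addr0 D_prod.
Qed.

(** The index i of the differentiated direction and the permutation s of the
    remaining labels make up the permutation lift_perm ord0 i s of all labels,
    whose sign is the product of (-1)^i and of the sign of s. *)
Lemma ext_d_omega : ext_d (pullback (param t)
    (fun x => wedge_exp (kahler_form (J t) (ds2 t) x) n)) 0 dir =
  (2 ^+ n)^-1 * \sum_(i : label) \sum_(s : 'S_(n.*2)) \sum_k term (lift_perm ord0 i s) k.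
Proof.
rewrite /ext_d mulr_sumr; apply: eq_bigr => i _.
rewrite [X in _ * X]D_wedge_exp_omega mulrCA; congr (_ * _).
rewrite mulr_sumr; apply: eq_bigr => s _; rewrite mulrA mulr_sumr.
apply: eq_bigr => k _; rewrite /dterm odd_lift_perm addFb signr_addb signr_odd.
rewrite (lift_perm_id ord0 i s) (lift_perm_ix i s) (lift_perm_iz i s).
by under [in RHS]eq_bigr => a _ do rewrite (lift_perm_ix i s) (lift_perm_iz i s).
Qed.

(** The derivative along z_1 of omega (th, x_1), times the product of the
    omega (x_a, z_a) for a > 1: the labels other than that of z_1, in their
    natural order, are th, x_1, x_2, z_2, ... *)
Lemma term_gt0 (a : 'I_n) : a = 0%N :> nat -> 0 < term (lift_perm ord0 (iz a) 1) a.
Proof.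
move=> a0; have la0 : lift (iz a) (pair_pos a ord0) = ord0.
  by apply: val_inj; rewrite /= /bump /= a0.
have la1 : lift (iz a) (pair_pos a ord_max) = ix a.
  by apply: val_inj; rewrite /= /bump /= a0.
have lb0 b : b != a -> lift (iz a) (pair_pos b ord0) = ix b.
  rewrite -val_eqE /= a0 => ba.
  by apply: val_inj; rewrite /= /bump /= a0; lia.
have lb1 b : b != a -> lift (iz a) (pair_pos b ord_max) = iz b.
  rewrite -val_eqE /= a0 => ba.
  by apply: val_inj; rewrite /= /bump /= a0; lia.
rewrite /dterm odd_lift_perm odd_perm1 addFb addbF lift_perm_id /=.
rewrite lift_perm_ix lift_perm_iz !perm1 la0 la1 /= a0 /= expr0 mul1r mulr_gt0 //.
  rewrite /domega_at0 D_omega_origin // /matched (bigD1 a) //= !eqxx mulr_gt0 // ltr_pwDl //.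
  by apply: sumr_ge0.
apply: prodr_gt0 => b ba.
rewrite lift_perm_ix lift_perm_iz !perm1 lb0 // lb1 // /omega_at0 omega_origin //.
by rewrite (pairing_ef _ ix_inj ix_neq_iz) mulr1.
Qed.

End Terms.

Theorem proposition7 (R : realType) (l : nat) (t : R)
    (l3 : (3 <= l)%N) (t4 : 0 < t < pi / 4) :
  ~ balanced l.-1 (@Mt R l t) (@J R l t) (@ds2 R l t).
Proof.
case: l l3 => [|[|[|n]]] // n0 bal.
have := bal setT (param t) (param_local n.+1 t4) 0 I (@dir R n.+1).
rewrite ext_d_omega //; apply/eqP.
rewrite mulf_neq0 ?invr_eq0 ?expf_neq0 ?pnatr_eq0 // gt_eqF //.
have ge0 s k := term_ge0 t4 (n := n.+1) s k.
pose a0 : 'I_n.+1 := ord0.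
(* No term is negative; the sums are peeled off around the positive term. *)
rewrite (bigD1 (iz a0)) //= ltr_pwDl //; last first.
  by do 3![apply: sumr_ge0 => ? _].
rewrite (bigD1 1%g) //= ltr_pwDl //; last by do 2![apply: sumr_ge0 => ? _].
rewrite (bigD1 a0) //= ltr_pwDl ?term_gt0 //.
by apply: sumr_ge0 => ? _.
Qed.
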